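(* Let $P\subset \mathbb{R}^3$ be a centrally symmetric convex polytope with nonempty interior. Then there is a constant $\lambda$ with $A(P,z)=\lambda$ for every nonzero $z\in\mathbb{R}^3$ if and only if $P$ is a zonotope whose generator set $V$ satisfies $2\deg v=\lambda$ for every $v\in V$, where $\deg v$ is the degree of $v$ in the hypergraph $\mathcal{F}$ associated with $V$.
   Context: For a convex polytope $P\subset\mathbb{R}^3$ with nonempty interior and a nonzero vector $z\in\mathbb{R}^3$, put $t^-=\min\{zx:x\in P\}$ and $t^+=\max\{zx:x\in P\}$, where $zx$ denotes the scalar product. For $t\in[t^-,t^+]$ let $P(z,t)=P\cap\{x\in\mathbb{R}^3: zx=t\}$, a convex polygon. Define $$A(P,z)=\frac{1}{t^+-t^-}\int_{t^-}^{t^+}\#\{\text{vertices of }P(z,t)\}\,dt.$$ A zonotope is a Minkowski sum $[0,a_1]+\dots+[0,a_n]$ of segments, where $a_1,\dots,a_n\in\mathbb{R}^3$ are pairwise non-collinear vectors and $n\ge 3$; the vectors $a_i$ are its generators and $V=\{a_1,\dots,a_n\}$ is its generator set. The hypergraph $\mathcal{F}$ has vertex set $V$, and a subset $W\subseteq V$ is an edge of $\mathcal{F}$ if $\dim \operatorname{lin} W=2$ and $W$ is maximal with this property, i.e. $\dim\operatorname{lin}(W\cup\{v\})=3$ for every $v\in V\setminus W$. The degree $\deg v$ of $v\in V$ is the number of edges of $\mathcal{F}$ containing $v$.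
   Formalization: ''P is a zonotope'' is read up to translation: P is a translate of [0,a_1]+...+[0,a_n]. Literally the claim fails for the cube [-1,1]^3, which has A = 4 for every z but is not itself such a sum. *)

(* Defs.v *)
From HB Require Import structures.
From mathcomp Require Import all_boot all_order all_algebra finmap.
From mathcomp Require Import all_classical all_reals all_analysis.

Set Implicit Arguments.
Unset Strict Implicit.
Unset Printing Implicit Defensive.

Import Order.TTheory GRing.Theory Num.Theory.
Import numFieldNormedType.Exports.

Local Open Scope classical_set_scope.
Local Open Scope ring_scope.

Section Polytopes.
Context {R : realType}.
Local Notation E := 'rV[R]_3.
Implicit Types (P Q S : set E) (z v : E).

Definition dot z (x : E) : R := \sum_(k < 3) z 0 k * x 0 k.

Definition convex_hull S : set E := smallest (@convex_set R E) S.

Definition convex_polytope P : Prop :=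
  exists2 S : set E, finite_set S & P = convex_hull S.

Definition centrally_symmetric P : Prop :=
  exists c : E, forall x, P x <-> P (c + c - x).

Definition vertices Q : set E :=
  [set v | Q v /\
    forall (x y : E) (s : R), Q x -> Q y -> 0 < s < 1 ->
      v = s *: x + (1 - s) *: y -> x = y].

Definition slice P z (t : R) : set E := P `&` [set x | dot z x = t].

(* A nonempty polytope is compact, so these bounds are attained. *)
Definition tmin P z : R := inf [set dot z x | x in P].
Definition tmax P z : R := sup [set dot z x | x in P].

(* [fset_set] sends infinite sets to [fset0]; slices of polytopes have finitely
   many vertices. *)
Definition nb_vertices Q : nat := #|` fset_set (vertices Q)|.

Definition avg_vertices P z : R :=
  (tmax P z - tmin P z)^-1 *
  \int[lebesgue_measure]_(t in `[tmin P z, tmax P z])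
     (nb_vertices (slice P z t))%:R.

Definition segment0 (a : E) : set E := [set s *: a | s in `[0, 1]].

Definition minkowski_sum n (S : 'I_n -> set E) : set E :=
  [set \sum_i x i | x in [set x : 'I_n -> E | forall i, S i (x i)]].

Definition zonotope n (a : 'I_n -> E) : set E :=
  minkowski_sum (fun i => segment0 (a i)).

Definition dim_lin (W : {fset E}) : nat := \dim <<enum_fset W>>%VS.

(* A pair containing 0 is collinear, so the generators are nonzero. *)
Definition pairwise_noncollinear n (a : 'I_n -> E) : Prop :=
  forall i j, i != j -> free [:: a i; a j].

Definition translate (c : E) Q : set E := [set c + x | x in Q].

(* Equality up to translation: a sum [0, a_1] + ... + [0, a_n] has its centre at
   (a_1 + ... + a_n) / 2, so for instance a cube centred at the origin is only a
   translate of such a sum. *)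
Definition is_zonotope_generated_by P n (a : 'I_n -> E) : Prop :=
  [/\ (3 <= n)%N, pairwise_noncollinear a &
      exists c : E, P = translate c (zonotope a)].

Definition generator_set n (a : 'I_n -> E) : {fset E} :=
  [fset a i | i in 'I_n]%fset.

Definition hyperedge (V W : {fset E}) : Prop :=
  [/\ (W `<=` V)%fset, dim_lin W = 2%N &
      forall v, v \in (V `\` W)%fset -> dim_lin (v |` W)%fset = 3%N].

Definition degree (V : {fset E}) v : nat :=
  #|` [fset W in fpowerset V | `[< hyperedge V W >] && (v \in W)]%fset|.

End Polytopes.

(* Main.v *)
Require Import Defs.
From HB Require Import structures.
From mathcomp Require Import all_boot all_order all_algebra finmap.
From mathcomp Require Import all_classical all_reals all_analysis.
From mathcomp Require Import ring lra.
Set Implicit Arguments.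
Unset Strict Implicit.
Unset Printing Implicit Defensive.
Import Order.TTheory GRing.Theory Num.Theory.
Import numFieldNormedType.Exports.
Local Open Scope classical_set_scope.
Local Open Scope ring_scope.

(** For [t] outside a finite set, the vertices of the slice [P(z,t)] are the
    points where the plane crosses the edges of [P], so that
    [A(P,z) * (t^+ - t^-)] is the sum of [|z . e|] over the edges [e] of [P].
    If [A(P,z) = lambda], then [lambda] times the width of [P] is this sum.
    For a centrally symmetric [P] the width determines the support function up
    to translation, hence [P] is the zonotope generated by the edge vectors
    divided by [lambda], after merging the collinear ones.
    For a zonotope with generators [a_i], the edges parallel to [a_i] correspond
    to the cells cut out in the plane orthogonal to [a_i] by the lines
    orthogonal to the other generators. The number of distinct lines is the
    degree of [a_i], so there are twice as many cells. Therefore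
    [A(P,z) * (t^+ - t^-)] is the sum of [2 deg a_i |z . a_i|], while the width
    is the sum of [|z . a_i|], and the functions [|z . a_i|] are linearly
    independent. *)

(** * Convex hulls and separation *)

Section Convexity.
Context {R : realType}.
Local Notation E := 'rV[R]_3.
Implicit Types (A P : set E) (x y z u w : E).

(** The face lattice never enters. An edge is an ordered pair of ends of a segment that is an
    extreme subset of [P], and the obstacle is to show that every vertex of a generic slice lies on
    one. This goes through the smallest face containing the vertex: it meets the slicing plane in
    that point alone, hence lies on a line. With ordered pairs, only the orientation ascending along
    [z] counts at a given height; passing to absolute values then costs a factor 1/2, which the two
    orientations of each zonotope edge give back. Cells are recorded by sign vectors instead of
    subsets of the plane, so that they can be counted by adding one line at a time: a repeated line
    changes nothing, the first line splits one cell, and each later one splits the two cells around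
    its opposite rays. That every edge of a zonotope comes from a cell rests on a theorem of the
    alternative, proved by separating the origin from a convex hull. *)

Lemma dotC x y : dot x y = dot y x.
Proof. by apply: eq_bigr => i _; rewrite mulrC. Qed.

Lemma dotDr z x y : dot z (x + y) = dot z x + dot z y.
Proof. by rewrite -big_split; apply: eq_bigr => i _; rewrite mxE mulrDr. Qed.

Lemma dotZr z (k : R) x : dot z (k *: x) = k * dot z x.
Proof. by rewrite mulr_sumr; apply: eq_bigr => i _; rewrite mxE mulrCA. Qed.

Lemma dotDl z x y : dot (x + y) z = dot x z + dot y z.
Proof. by rewrite ![dot _ z]dotC dotDr. Qed.

Lemma dotZl z (k : R) x : dot (k *: x) z = k * dot x z.
Proof. by rewrite ![dot _ z]dotC dotZr. Qed.

Lemma dotNr z x : dot z (- x) = - dot z x.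
Proof. by rewrite -scaleN1r dotZr mulN1r. Qed.

Lemma dotNl z x : dot (- x) z = - dot x z.
Proof. by rewrite -scaleN1r dotZl mulN1r. Qed.

Lemma dotBr z x y : dot z (x - y) = dot z x - dot z y.
Proof. by rewrite dotDr dotNr. Qed.

Lemma dotBl z x y : dot (x - y) z = dot x z - dot y z.
Proof. by rewrite dotDl dotNl. Qed.

Lemma dot0r z : dot z 0 = 0.
Proof. by rewrite -(scale0r (0 : E)) dotZr mul0r. Qed.

Lemma dot0l z : dot 0 z = 0.
Proof. by rewrite dotC dot0r. Qed.

Lemma dot_sumr z (I : Type) (r : seq I) (Q : pred I) (F : I -> E) :
  dot z (\sum_(i <- r | Q i) F i) = \sum_(i <- r | Q i) dot z (F i).
Proof. by apply: (big_morph (dot z) (dotDr z) (dot0r z)). Qed.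

Lemma dot_ge0 x : 0 <= dot x x.
Proof. by apply: sumr_ge0 => i _; rewrite -expr2 sqr_ge0. Qed.

Lemma dot_eq0 x : (dot x x == 0) = (x == 0).
Proof.
apply/idP/eqP => [|->]; last by rewrite dot0r.
rewrite psumr_eq0 => [/allP h|i _]; last by rewrite -expr2 sqr_ge0.
apply/rowP => i; rewrite mxE; have := h i (mem_index_enum i).
by rewrite mulf_eq0 orbb => /eqP.
Qed.

Lemma dot_gt0 x : (0 < dot x x) = (x != 0).
Proof. by rewrite lt_def dot_ge0 andbT dot_eq0. Qed.

Lemma continuous_dot (T : topologicalType) (f g : T -> E) :
  continuous f -> continuous g -> continuous (fun t => dot (f t) (g t)).
Proof.
move=> cf cg; apply: continuous_big => [|k _].
  by move=> p; apply: add_continuous.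
move=> t; apply: (@continuousM _ _ (fun t => f t 0 k) (fun t => g t 0 k)).
- exact: (continuous_comp (cf t) (@coord_continuous _ _ _ _ _ _)).
- exact: (continuous_comp (cg t) (@coord_continuous _ _ _ _ _ _)).
Qed.

Definition cvx A := forall x y (s : R), A x -> A y -> 0 <= s <= 1 ->
  A (s *: x + (1 - s) *: y).

Lemma convex_setP A : @convex_set R E A <-> cvx A.
Proof.
split=> [cA x y s Ax Ay /andP[s0 s1]|cA x y s].
  by have := cA x y (Itv01 s0 s1) (mem_set Ax) (mem_set Ay); rewrite inE.
rewrite !inE => Ax Ay; apply: cA => //.
by rewrite ge0 le1.
Qed.

(** [D] is the set of indices allowed to carry weight. It lets a hull omit one vector without
    reindexing the family. *)
Definition simplex m (D : pred 'I_m) : set 'rV[R]_m :=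
  [set c | [/\ forall i, 0 <= c 0 i, \sum_i c 0 i = 1
             & forall i, ~~ D i -> c 0 i = 0]].

Definition lincomb m (v : 'I_m -> E) (c : 'rV[R]_m) : E :=
  \sum_i c 0 i *: v i.

Definition hull m (D : pred 'I_m) (v : 'I_m -> E) : set E :=
  lincomb v @` simplex D.

Lemma lincombD m (v : 'I_m -> E) c d :
  lincomb v (c + d) = lincomb v c + lincomb v d.
Proof. by rewrite -big_split; apply: eq_bigr => i _; rewrite mxE scalerDl. Qed.

Lemma lincombZ m (v : 'I_m -> E) (k : R) c :
  lincomb v (k *: c) = k *: lincomb v c.
Proof. by rewrite scaler_sumr; apply: eq_bigr => i _; rewrite mxE scalerA. Qed.

Lemma continuous_lincomb m (v : 'I_m -> E) : continuous (lincomb v).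
Proof.
apply: continuous_big => [|k _].
  by move=> p; apply: add_continuous.
move=> c; apply: (@continuousZr_tmp _ _ _ (fun c : 'rV[R]_m => c 0 k) (v k)).
exact: coord_continuous.
Qed.

Lemma simplex_compact m (D : pred 'I_m) : compact (simplex D).
Proof.
have cbox : compact [set c : 'rV[R]_m | forall i, `[0, 1]%classic (c 0 i)].
  exact (@rV_compact R m (fun=> `[0, 1]%classic)
    (fun=> @segment_compact _ _ _)).
apply: (subclosed_compact _ cbox); last first.
  move=> c [c0 c1 _] i /=; rewrite in_itv /= c0 -c1 (bigD1 i) //= lerDl.
  by apply: sumr_ge0.
have -> : simplex D = \bigcap_i [set c | 0 <= c 0 i] `&`
    [set c | \sum_i c 0 i = 1] `&`
    \bigcap_(i in [set i | ~~ D i]) [set c | c 0 i = 0].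
  apply/seteqP; split=> c /=; first by
    case=> c0 c1 cD; split; [split=> // i _; apply: c0 | move=> i; apply: cD].
  by move=> [[c0 c1] cD]; split; [move=> i; apply: c0 | | apply: cD].
apply: closedI; first apply: closedI.
- apply: closed_bigI => i _.
  apply: (@preimage_closed _ _ (fun c : 'rV[R]_m => c 0 i)) (@closed_ge _ _).
  by move=> c _; apply: coord_continuous.
- apply: (@preimage_closed _ _ (fun c : 'rV[R]_m => \sum_i c 0 i))
    (@closed_eq _ _).
  move=> c _; move: c; apply: continuous_big => [|k _].
    by move=> p; apply: add_continuous.
  by move=> c; apply: coord_continuous.
- apply: closed_bigI => i _.
  apply: (@preimage_closed _ _ (fun c : 'rV[R]_m => c 0 i)) (@closed_eq _ _).
  by move=> c _; apply: coord_continuous.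
Qed.

Lemma hull_compact m (D : pred 'I_m) (v : 'I_m -> E) : compact (hull D v).
Proof.
apply: continuous_compact; last exact: simplex_compact.
exact/continuous_subspaceT/continuous_lincomb.
Qed.

Lemma hull_cvx m (D : pred 'I_m) (v : 'I_m -> E) : cvx (hull D v).
Proof.
move=> _ _ s [c [c0 c1 cD] <-] [d [d0 d1 dD] <-] /andP[s0 s1].
exists (s *: c + (1 - s) *: d); last by rewrite lincombD !lincombZ.
split=> [i||i /[dup] /cD ci /dD di].
- by rewrite !mxE addr_ge0 ?mulr_ge0 ?subr_ge0.
- under eq_bigr do rewrite !mxE.
  by rewrite big_split -!mulr_sumr /= c1 d1; ring.
- by rewrite !mxE ci di !mulr0 addr0.
Qed.

Lemma hull_vertex m (D : pred 'I_m) (v : 'I_m -> E) i : D i -> hull D v (v i).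
Proof.
move=> Di; exists (delta_mx 0 i).
  split=> [j||j nDj].
  - by rewrite mxE eqxx /=; case: (j == i); rewrite ?ler01.
  - rewrite (bigD1 i) //= mxE !eqxx big1 ?addr0 // => j /negPf ji.
    by rewrite mxE ji andbF.
  - by rewrite mxE eqxx /=; case: eqP nDj => // ->; rewrite Di.
rewrite /lincomb (bigD1 i) //= mxE !eqxx scale1r big1 ?addr0 // => j /negPf ji.
by rewrite mxE ji andbF scale0r.
Qed.

Lemma hull_min m (D : pred 'I_m) (v : 'I_m -> E) A :
  cvx A -> (forall i, D i -> A (v i)) -> hull D v `<=` A.
Proof.
move=> cA Av _ [c [c0 c1 cD] <-].
(* Partial weights do not sum to 1, so the induction over the index list runs on normalised partial
   sums. *)
suff H r : 0 < \sum_(i <- r) c 0 i ->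
    A ((\sum_(i <- r) c 0 i)^-1 *: \sum_(i <- r) c 0 i *: v i).
  by have := H (index_enum _); rewrite c1 invr1 scale1r; apply; apply: ltr01.
elim: r => [|i r IH]; first by rewrite big_nil ltxx.
rewrite !big_cons => s0.
have [ci0|ci0] := eqVneq (c 0 i) 0.
  by move: s0; rewrite ci0 !add0r scale0r add0r.
have Avi : A (v i).
  by apply: Av; apply: contraNT ci0 => /cD ->.
have r0 : 0 <= \sum_(i <- r) c 0 i by apply: sumr_ge0.
have [rE|rN] := eqVneq (\sum_(i <- r) c 0 i) 0.
  have r0' : \sum_(i <- r) c 0 i *: v i = 0.
    rewrite big_seq big1 // => j jr; suff -> : c 0 j = 0 by rewrite scale0r.
    by move: rE => /eqP; rewrite psumr_eq0 // => /allP /(_ j jr) /= /eqP.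
  by rewrite rE r0' !addr0 scalerA mulVf // scale1r.
have {}IH := IH _; rewrite lt_def rN r0 in IH; have {IH} Ay := IH isT.
set C := c 0 i in s0 ci0 *; set B := \sum_(i <- r) _ in s0 r0 rN Ay *.
have C0 : 0 <= C by apply: c0.
have /(cA _ _ _ Avi Ay) : 0 <= C / (C + B) <= 1.
  by rewrite divr_ge0 ?addr_ge0 //= ler_pdivrMr // mul1r lerDl.
rewrite scalerDr !scalerA.
have -> : (1 - C / (C + B)) / B = (C + B)^-1.
  by field; rewrite rN gt_eqF.
by rewrite mulrC.
Qed.

Lemma convex_hullE A : finite_set A ->
  exists m (v : 'I_m -> E), convex_hull A = hull predT v.
Proof.
move=> /finite_seqP[s ->].
exists (size s), (fun i => s`_i); apply/seteqP; split.
  apply: smallest_sub; first by apply/convex_setP; apply: hull_cvx.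
  move=> x /= xs; have xi : (index x s < size s)%N by rewrite index_mem.
  have := @hull_vertex _ predT (fun i : 'I_(size s) => s`_i) (Ordinal xi) isT.
  by rewrite /= nth_index.
move=> x hx B /= [/convex_setP cB sB]; move: x hx.
by apply: hull_min => // i _; apply: sB => /=; apply: mem_nth.
Qed.

Lemma separation (K : set E) p : compact K -> cvx K -> K !=set0 -> ~ K p ->
  exists z, forall x, K x -> dot z p < dot z x.
Proof.
move=> cK vK K0 nKp.
have cf : {within K, continuous (fun x => dot (x - p) (x - p))}.
  have cp : continuous (fun x => x - p).
    by move=> x; apply: (cvgB cvg_id (cvg_cst p)).
  exact/continuous_subspaceT/continuous_dot.
have [q /set_mem Kq qmin] := compact_EVT_min K0 cK cf.
have qp : q - p != 0 by rewrite subr_eq0; apply: contra_not_neq nKp => <-.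
exists (q - p) => x Kx.
have d0 : 0 < dot (q - p) (q - p) by rewrite dot_gt0.
suff : 0 <= dot (q - p) (x - q).
  rewrite !dotBr in d0 *; lra.
rewrite leNgt; apply/negP => neg.
have {}qmin s : 0 <= s <= 1 ->
    0 <= s * (s * dot (x - q) (x - q) + 2 * dot (q - p) (x - q)).
  move=> s01; have := qmin _ (mem_set (vK _ _ s Kx Kq s01)).
  have -> : s *: x + (1 - s) *: q - p = s *: (x - q) + (q - p).
    by apply/rowP => i; rewrite !mxE; ring.
  move: (x - q) (q - p) => e d.
  rewrite !dotDr !dotDl !dotZr !dotZl (dotC e d); lra.
have := dot_ge0 (x - q); move: neg qmin.
set a := dot (x - q) _; set b := dot (q - p) _ => neg qmin a0.
have ab : 0 < a - b by lra.
(* The value s (s a + 2 b) is negative as soon as s > 0 and s a < -2 b. This [s] satisfies both,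
   does not exceed 1, and avoids a case distinction on [a = 0]. *)
have s0 : 0 < - b / (a - b) by rewrite divr_gt0 // oppr_gt0.
have /qmin : 0 <= - b / (a - b) <= 1.
  by rewrite (ltW s0) /= ler_pdivrMr // mul1r; lra.
apply/negP; rewrite -ltNge pmulr_rlt0 //.
suff : - b / (a - b) * a <= - b by lra.
by rewrite mulrAC ler_pdivrMr //; have := sqr_ge0 b; rewrite expr2; lra.
Qed.

(** A point of [K] farthest from the origin is extreme, because the squared norm is strictly
    convex. *)
Lemma compact_vertex (K : set E) : compact K -> K !=set0 -> vertices K !=set0.
Proof.
move=> cK K0.
have cf : {within K, continuous (fun x => dot x x)}.
  have cid : continuous (fun x : E => x) by move=> x; apply: cvg_id.
  exact: continuous_subspaceT (continuous_dot cid cid).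
have [q /set_mem Kq qmax] := compact_EVT_max K0 cK cf.
exists q; split=> // x y s Kx Ky /andP[s0 s1] qE.
have := qmax _ (mem_set Kx); have := qmax _ (mem_set Ky).
have qq : dot q q = s * dot x x + (1 - s) * dot y y
    - s * (1 - s) * dot (x - y) (x - y).
  rewrite qE !dotDr !dotDl !dotZr !dotZl !dotNr !dotNl (dotC y x); ring.
move=> yq xq; apply/eqP; rewrite -subr_eq0 -dot_eq0 eq_le dot_ge0 andbT.
have : s * (1 - s) * dot (x - y) (x - y) <= 0 by nra.
by rewrite pmulr_rle0 // mulr_gt0 // subr_gt0.
Qed.

End Convexity.

(** * Edges of a polytope *)

Section Edges.
Context {R : realType}.
Local Notation E := 'rV[R]_3.
Implicit Types (P : set E) (x y z u w : E).

Definition seg u w : set E :=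
  [set q | exists2 r : R, 0 <= r <= 1 & q = u + r *: (w - u)].

(** The segment is an extreme subset of [P], with its ends as an ordered pair. The conclusion for
    [y] follows by exchanging [x] and [y], see [edge_swap]. *)
Definition edge P u w : Prop :=
  [/\ u != w, P u, P w & forall x y (s : R), P x -> P y -> 0 < s < 1 ->
      seg u w (s *: x + (1 - s) *: y) -> seg u w x].

(** The point at height [t] on the line through [u] and [w]; if both ends have the same height, the
    division by zero yields [u]. *)
Definition cross z (t : R) u w : E :=
  u + ((t - dot z u) / (dot z w - dot z u)) *: (w - u).

Lemma seg_sym u w x : seg u w x -> seg w u x.
Proof.
move=> [r /andP[r0 r1] ->]; exists (1 - r); first by apply/andP; split; lra.
by apply/rowP => i; rewrite !mxE; ring.
Qed.

Lemma edge_sym P u w : edge P u w -> edge P w u.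
Proof.
move=> [uw Pu Pw h]; split=> //; first by rewrite eq_sym.
by move=> x y s Px Py s01 /seg_sym/h => /(_ Px Py s01)/seg_sym.
Qed.

Lemma edge_swap P u w x y (s : R) : edge P u w -> P x -> P y -> 0 < s < 1 ->
  seg u w (s *: x + (1 - s) *: y) -> seg u w y.
Proof.
move=> [_ _ _ h] Px Py /andP[s0 s1] su; apply: (h y x (1 - s)) => //.
  by apply/andP; split; lra.
by rewrite addrC (_ : 1 - (1 - s) = s) //; ring.
Qed.

Lemma seg_l u w : seg u w u.
Proof. by exists 0; rewrite ?lexx ?ler01 // scale0r addr0. Qed.

Lemma seg_r u w : seg u w w.
Proof. exact/seg_sym/seg_l. Qed.

Lemma seg_dot z u w x : dot z u < dot z w -> seg u w x ->
  dot z u <= dot z x <= dot z w.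
Proof.
move=> uw [r /andP[r0 r1] ->]; rewrite dotDr dotZr dotBr.
have := mulr_ge0 r0 (ltW (_ : 0 < dot z w - dot z u)).
rewrite subr_gt0 => /(_ uw) h1.
have := mulr_ge0 (_ : 0 <= 1 - r) (ltW (_ : 0 < dot z w - dot z u)).
rewrite !subr_ge0 subr_gt0 => /(_ r1 uw) h2.
apply/andP; split; lra.
Qed.

Lemma segE z u w x : dot z u < dot z w -> seg u w x ->
  x = cross z (dot z x) u w.
Proof.
move=> uw [r _ ->]; rewrite /cross dotDr dotZr dotBr addrAC subrr add0r.
by rewrite mulfK // subr_eq0 gt_eqF.
Qed.

Lemma cross_seg z (t : R) u w : dot z u < dot z w -> dot z u <= t <= dot z w ->
  seg u w (cross z t u w).
Proof.
move=> uw /andP[ut tw]; eexists; last by [].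
have h : 0 < dot z w - dot z u by rewrite subr_gt0.
by rewrite divr_ge0 ?subr_ge0 ?(ltW uw) //= ler_pdivrMr // mul1r; lra.
Qed.

Lemma dot_cross z (t : R) u w : dot z u != dot z w -> dot z (cross z t u w) = t.
Proof.
move=> uw; rewrite dotDr dotZr dotBr divfK; first by rewrite addrC subrK.
by rewrite subr_eq0 eq_sym.
Qed.

Lemma crossE z (t : R) u w : dot z u < t < dot z w ->
  exists2 s : R, 0 < s < 1 & cross z t u w = s *: u + (1 - s) *: w.
Proof.
move=> /andP[ut tw]; have h : 0 < dot z w - dot z u by lra.
exists (1 - (t - dot z u) / (dot z w - dot z u)).
  rewrite subr_gt0 ltr_pdivrMr // mul1r ltrBlDr subrK tw /=.
  by rewrite gtrBl divr_gt0 // subr_gt0.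
by rewrite /cross; apply/rowP => i; rewrite !mxE; ring.
Qed.

Lemma edge_cvx P u w : cvx P -> edge P u w -> seg u w `<=` P.
Proof.
move=> cP [_ Pu Pw _] _ [r /andP[r0 r1] ->].
have -> : u + r *: (w - u) = r *: w + (1 - r) *: u.
  by apply/rowP => i; rewrite !mxE; ring.
by apply: cP => //; rewrite r0.
Qed.

(** Extremeness of the edge puts both ends of any decomposition within the slice on the segment,
    where the height determines the point. *)
Lemma cross_vertex P z (t : R) u w : cvx P -> edge P u w ->
  dot z u < t < dot z w -> vertices (slice P z t) (cross z t u w).
Proof.
move=> cP ed /andP[ut tw]; have uw := lt_trans ut tw.
have cs : seg u w (cross z t u w) by apply: cross_seg => //; rewrite !ltW.
split.
  split; first exact: edge_cvx cs.
  by rewrite /= dot_cross // lt_eqF.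
move=> x y s [Px xt] [Py yt] s01 e; rewrite e in cs.
have [_ _ _ h] := ed.
have sx := h _ _ _ Px Py s01 cs; have sy := edge_swap ed Px Py s01 cs.
by rewrite (segE uw sx) (segE uw sy) xt yt.
Qed.

Lemma edge_between P z (t : R) u w u' w' : edge P u w -> edge P u' w' ->
  dot z u < t < dot z w -> dot z u' < t < dot z w' ->
  cross z t u w = cross z t u' w' -> seg u' w' u /\ seg u' w' w.
Proof.
move=> ed ed' t1 /andP[ut tw] e; have uw := lt_trans ut tw.
have := cross_seg uw (_ : dot z u' <= t <= dot z w').
rewrite !ltW // -e => /(_ isT).
have [s s01 ->] := crossE t1; have [_ Pu Pw _] := ed.
have [_ _ _ h] := ed' => su; split; first exact: h su.
exact: (edge_swap ed' Pu Pw s01 su).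
Qed.

(** Two edges with a common inner point contain each other, so their ends have equal heights, and on
    a segment the height determines the point. *)
Lemma cross_inj P z (t : R) u w u' w' : edge P u w -> edge P u' w' ->
  dot z u < t < dot z w -> dot z u' < t < dot z w' ->
  cross z t u w = cross z t u' w' -> (u, w) = (u', w').
Proof.
move=> e e' t1 t2 c.
have [uw uw'] : dot z u < dot z w /\ dot z u' < dot z w'.
  by case/andP: t1 => ? ?; case/andP: t2 => ? ?; split; lra.
have [a b] := edge_between e e' t1 t2 c.
have [a' b'] := edge_between e' e t2 t1 (esym c).
have /andP[l1 l2] := seg_dot uw' a; have /andP[l3 l4] := seg_dot uw' b.
have /andP[l1' l2'] := seg_dot uw a'; have /andP[l3' l4'] := seg_dot uw b'.
rewrite (segE uw' a) (segE uw' b).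
have -> : dot z u = dot z u' by lra.
have -> : dot z w = dot z w' by lra.
by rewrite -(segE uw' (seg_l _ _)) -(segE uw' (seg_r _ _)).
Qed.

Lemma edge_vertex P u w : edge P u w -> vertices P u.
Proof.
move=> ed; have [uw Pu Pw h] := ed; split=> // x y s Px Py s01 uE.
have us : seg u w (s *: x + (1 - s) *: y) by rewrite -uE; apply: seg_l.
have [r /andP[r0 _] xE] := h _ _ _ Px Py s01 us.
have [r' /andP[r0' _] yE] := edge_swap ed Px Py s01 us.
(* Along the segment, [u] has parameter 0, which is a convex combination of the nonnegative
   parameters of [x] and [y]. *)
have : (s * r + (1 - s) * r') *: (w - u) == 0.
  apply/eqP; transitivity (s *: x + (1 - s) *: y - u); last by rewrite -uE subrr.
  by rewrite xE yE; apply/rowP => i; rewrite !mxE; ring.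
rewrite scaler_eq0 subr_eq0 (eq_sym w) (negPf uw) orbF => /eqP e.
have [s0 s1] : 0 < s /\ 0 < 1 - s by case/andP: s01 => ? ?; split; lra.
have sr := mulr_ge0 (ltW s0) r0; have sr' := mulr_ge0 (ltW s1) r0'.
have /eqP : s * r = 0 by lra.
have /eqP : (1 - s) * r' = 0 by lra.
rewrite !mulf_eq0 (gt_eqF s0) (gt_eqF s1) /= => /eqP r'E /eqP rE.
by rewrite xE yE r'E rE.
Qed.

Section Hull.
Variables (m : nat) (v : 'I_m -> E).
Local Notation P := (hull predT v).

(** The step length [c 0 i] is admissible: the new weight of [v i] is the square of the old one, and
    the other weights do not decrease. *)
Lemma hull_extend c i : simplex predT c ->
  P (lincomb v c + c 0 i *: (lincomb v c - v i)).
Proof.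
move=> [c0 c1 _]; exists (c + c 0 i *: (c - delta_mx 0 i)).
  split=> // [j|].
  - rewrite !mxE eqxx /=; have := c0 i; have := c0 j.
    case: eqP => [->|_] /= a b; last by have := mulr_ge0 b a; lra.
    by have := sqr_ge0 (c 0 i); rewrite expr2; lra.
  - under eq_bigr do rewrite !mxE mulrBr.
    rewrite big_split /= sumrB -mulr_sumr c1.
    rewrite [X in _ - X](bigD1 i) //= !eqxx big1; first by rewrite /=; ring.
    by move=> j /negPf ->; rewrite mulr0.
rewrite lincombD lincombZ; congr (_ + _ *: _).
rewrite -scaleN1r lincombD lincombZ scaleN1r; congr (_ - _).
rewrite /lincomb (bigD1 i) //= mxE !eqxx scale1r big1 ?addr0 // => j /negPf ji.
by rewrite mxE ji andbF scale0r.
Qed.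

Lemma simplex_pos (c : 'rV[R]_m) : simplex predT c -> exists i : 'I_m, 0 < c 0 i.
Proof.
move=> [c0 c1 _]; apply/existsP; rewrite -[X in is_true X]negbK.
rewrite negb_exists; apply/negP => /forallP h.
have : \sum_i c 0 i <= 0 by apply: sumr_le0 => i _; rewrite leNgt h.
by rewrite c1 leNgt ltr01.
Qed.

(** Any [v i] of positive weight will do: [x] lies strictly between it and the prolongation given by
    [hull_extend]. *)
Lemma vertices_hull x : vertices P x -> exists i, x = v i.
Proof.
move=> [[c cs xE] h]; have [i ci] := simplex_pos cs; exists i.
have Pe := hull_extend i cs; rewrite xE in Pe.
have Pv : P (v i) by apply: hull_vertex.
have ci1 : 0 < 1 + c 0 i by lra.
have e : v i = x + c 0 i *: (x - v i).
  apply: (h _ _ (c 0 i / (1 + c 0 i))) => //.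
    by rewrite divr_gt0 //= ltr_pdivrMr // mul1r; lra.
  apply/rowP => k; rewrite !mxE; field; exact: lt0r_neq0.
have /eqP : (1 + c 0 i) *: (x - v i) = 0.
  by rewrite scalerDl scale1r addrAC -e subrr.
by rewrite scaler_eq0 gt_eqF //= subr_eq0 => /eqP.
Qed.

Lemma edge_list : exists2 K : seq (E * E), uniq K &
  forall u w, (u, w) \in K <-> edge P u w.
Proof.
pose s := [seq v i | i <- enum 'I_m].
exists (undup [seq p <- allpairs pair s s | `[< edge P p.1 p.2 >]]).
  exact: undup_uniq.
move=> u w; rewrite mem_undup mem_filter; split=> [/andP[/asboolP //]|ed].
apply/andP; split; first exact/asboolP.
have [i uE] := vertices_hull (edge_vertex ed).
have [j wE] := vertices_hull (edge_vertex (edge_sym ed)).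
by apply: allpairs_f; rewrite ?uE ?wE map_f // mem_enum.
Qed.

End Hull.
End Edges.

(** * Vertices of slices *)

Section SliceVertex.
Context {R : realType}.
Local Notation E := 'rV[R]_3.
Variables (m : nat) (v : 'I_m -> E) (z x : E) (t : R).
Implicit Types y : E.
Local Notation P := (hull predT v).

(* The relative interior point [x] belongs to the smallest face of [P] that
   contains it, and this is the set of all [y] such that the segment from [y]
   to [x] can be prolonged beyond [x] inside [P]. *)
Definition face_at y : Prop :=
  P y /\ exists2 e : R, 0 < e & P (x + e *: (x - y)).

Lemma prolong_shrink (e e' : R) (d : E) : P x -> P (x + e *: d) ->
  0 <= e' <= e -> 0 < e -> P (x + e' *: d).
Proof.
move=> Px Pe /andP[e0 ee] egt0.
have -> : x + e' *: d = (e' / e) *: (x + e *: d) + (1 - e' / e) *: x.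
  by apply/rowP => i; rewrite !mxE; field; exact: lt0r_neq0.
apply: hull_cvx => //.
by rewrite divr_ge0 ?(ltW egt0) //= ler_pdivrMr // mul1r.
Qed.

Lemma face_at_cvx y y' (s : R) : P x -> face_at y -> face_at y' ->
  0 <= s <= 1 -> face_at (s *: y + (1 - s) *: y').
Proof.
move=> Px [Py [e e0 Pe]] [Py' [e' e'0 Pe']] s01; split; first exact: hull_cvx.
pose d := Num.min e e'; have d0 : 0 < d by rewrite lt_min e0.
exists d => //.
have -> : x + d *: (x - (s *: y + (1 - s) *: y')) =
    s *: (x + d *: (x - y)) + (1 - s) *: (x + d *: (x - y')).
  by apply/rowP => i; rewrite !mxE; ring.
apply: hull_cvx => //.
- by apply: (prolong_shrink Px Pe) => //; rewrite (ltW d0) ge_min lexx.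
- by apply: (prolong_shrink Px Pe') => //; rewrite (ltW d0) ge_min lexx orbT.
Qed.

Lemma face_at_extreme y y' (s : R) : 0 < s < 1 -> P y -> P y' ->
  face_at (s *: y + (1 - s) *: y') -> face_at y.
Proof.
move=> /andP[s0 s1] Py Py' [_ [e e0 Pe]]; split=> //.
have es : 0 < e * (1 - s) by rewrite mulr_gt0 // subr_gt0.
have D : 0 < 1 + e * (1 - s) by lra.
(* The prolongation beyond [x] is mixed with [y'] in the proportion that cancels the contribution of
   [y']. *)
exists (e * s / (1 + e * (1 - s))); first by rewrite divr_gt0 // mulr_gt0.
have -> : x + (e * s / (1 + e * (1 - s))) *: (x - y) =
    (1 + e * (1 - s))^-1 *: (x + e *: (x - (s *: y + (1 - s) *: y')))
    + (1 - (1 + e * (1 - s))^-1) *: y'.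
  by apply/rowP => i; rewrite !mxE; field; exact: lt0r_neq0.
apply: hull_cvx => //.
by rewrite invr_ge0 (ltW D) invf_le1 //; lra.
Qed.

Lemma face_at_vertices c i : simplex predT c -> face_at (lincomb v c) ->
  0 < c 0 i -> face_at (v i).
Proof.
move=> cs Fc ci; have Pe := hull_extend v i cs.
apply: (@face_at_extreme _ (lincomb v c + c 0 i *: (lincomb v c - v i))
  (c 0 i / (1 + c 0 i))) => //.
- by rewrite divr_gt0 /= ?ltr_pdivrMr ?mul1r; lra.
- exact: hull_vertex.
- have -> // : (c 0 i / (1 + c 0 i)) *: v i + (1 - c 0 i / (1 + c 0 i)) *:
    (lincomb v c + c 0 i *: (lincomb v c - v i)) = lincomb v c.
  apply/rowP => k; move: (lincomb v c) => l; rewrite !mxE; field.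
  by apply: lt0r_neq0; lra.
Qed.

Lemma face_at_self : P x -> face_at x.
Proof. by move=> Px; split=> //; exists 1; rewrite // subrr scaler0 addr0. Qed.

Lemma face_at_dot (y : E) (lo hi : R) :
  (forall i, face_at (v i) -> lo <= dot z (v i) <= hi) ->
  face_at y -> lo <= dot z y <= hi.
Proof.
move=> h Fy; have [[c cs cE] _] := Fy; rewrite -cE in Fy *.
have {}h i : c 0 i * lo <= c 0 i * dot z (v i) <= c 0 i * hi.
  have [c0 _ _] := cs; have := c0 i; rewrite le_eqVlt => /predU1P[<-|ci].
    by rewrite !mul0r lexx.
  have /h/andP[a b] := face_at_vertices cs Fy ci.
  by rewrite !ler_pM2l // a.
have [_ c1 _] := cs.
have -> : dot z (lincomb v c) = \sum_i c 0 i * dot z (v i).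
  by rewrite dot_sumr; apply: eq_bigr => i _; rewrite dotZr.
have lohi k : \sum_i c 0 i * k = k by rewrite -mulr_suml c1 mul1r.
rewrite -(lohi lo) -(lohi hi).
by apply/andP; split; apply: ler_sum => i _; case/andP: (h i).
Qed.

Hypothesis tv : forall i, dot z (v i) != t.
Hypothesis xv : vertices (slice P z t) x.

Let Px : P x. Proof. by have [[]] := xv. Qed.

(** At height [t] both [y] and its prolongation beyond [x] belong to the slice, with [x] strictly
    between them, and [x] is a vertex of the slice. *)
Lemma face_at_slice y : face_at y -> dot z y = t -> y = x.
Proof.
move=> [Py [e e0 Pe]] yt; have [[_ /= xt] h] := xv.
have e1 : 0 < 1 + e by lra.
have pE : y = x + e *: (x - y).
  apply: (h _ _ (e / (1 + e))).
  - by [].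
  - by split=> //=; rewrite dotDr dotZr dotBr xt yt; ring.
  - by rewrite divr_gt0 //= ltr_pdivrMr // mul1r; lra.
  - by apply/rowP => i; rewrite !mxE; field; exact: lt0r_neq0.
have /eqP : (1 + e) *: (x - y) = 0.
  by rewrite scalerDl scale1r addrAC -pE subrr.
by rewrite scaler_eq0 gt_eqF //= subr_eq0 => /eqP.
Qed.

Lemma face_at_cross y y' : face_at y -> face_at y' ->
  dot z y < t < dot z y' -> (t - dot z y) *: (y' - x) = (dot z y' - t) *: (x - y).
Proof.
move=> Fy Fy' tt; have xE : cross z t y y' = x.
  apply: face_at_slice; last first.
    by apply: dot_cross; case/andP: tt => ? ?; rewrite lt_eqF //; lra.
  have [s /andP[s0 s1] ->] := crossE tt.
  by apply: face_at_cvx => //; rewrite !ltW.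
rewrite -xE /cross; apply/rowP => i; rewrite !mxE; field.
by case/andP: tt => ? ?; rewrite subr_eq0 gt_eqF //; lra.
Qed.

(** The weights of [x] average the heights of the [v i] to [t]. As no height equals [t], positive
    weight occurs on both sides. *)
Lemma face_at_both_sides : (exists2 i, face_at (v i) & dot z (v i) < t) /\
  (exists2 i, face_at (v i) & t < dot z (v i)).
Proof.
have [c cs xE] := Px; have Fx := face_at_self Px; rewrite -xE in Fx.
have [_ xt] : slice P z t x by case: xv.
have [i ci] := simplex_pos cs; have [c0 c1 _] := cs.
have s0 : \sum_i c 0 i * (dot z (v i) - t) = 0.
  under eq_bigr do rewrite mulrBr.
  rewrite sumrB -mulr_suml c1 mul1r -[X in _ - X]xt -xE dot_sumr.
  by apply/eqP; rewrite subr_eq0; apply/eqP/eq_bigr => j _; rewrite dotZr.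
split; apply: contrapT => h.
- have nn j : 0 <= c 0 j * (dot z (v j) - t).
    have := c0 j; rewrite le_eqVlt => /predU1P[<-|cj]; first by rewrite mul0r.
    rewrite pmulr_rge0 // subr_ge0 leNgt; apply/negP => lt; apply: h.
    by exists j => //; apply: face_at_vertices cs Fx cj.
  move: s0 => /eqP; rewrite psumr_eq0 => [/allP/(_ i (mem_index_enum i))|//].
  by rewrite mulf_eq0 gt_eqF //= subr_eq0 (negPf (tv i)).
- have nn j : 0 <= - (c 0 j * (dot z (v j) - t)).
    rewrite -mulrN opprB.
    have := c0 j; rewrite le_eqVlt => /predU1P[<-|cj]; first by rewrite mul0r.
    rewrite pmulr_rge0 // subr_ge0 leNgt; apply/negP => lt; apply: h.
    by exists j => //; apply: face_at_vertices cs Fx cj.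
  have /eqP : \sum_i - (c 0 i * (dot z (v i) - t)) = 0.
    by rewrite sumrN s0 oppr0.
  rewrite psumr_eq0 => [/allP/(_ i (mem_index_enum i))|//].
  by rewrite oppr_eq0 mulf_eq0 gt_eqF //= subr_eq0 (negPf (tv i)).
Qed.

(** Since the smallest face at [x] meets the plane only in [x], it lies on a line through [x]; its
    lowest and highest [v i] are the ends of the edge. *)
Lemma vertex_cross : exists u w,
  [/\ edge P u w, dot z u < t < dot z w & x = cross z t u w].
Proof.
have [[i0 Fi0 i0t] [i1 Fi1 i1t]] := face_at_both_sides.
pose F := [pred i | `[< face_at (v i) >]].
have Fi0' : F i0 by apply/asboolP.
have Fi1' : F i1 by apply/asboolP.
case: (Order.TotalTheory.arg_minP (fun i => dot z (v i)) Fi0').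
move=> iu /asboolP Fu umin.
case: (Order.TotalTheory.arg_maxP (fun i => dot z (v i)) Fi1').
move=> iw /asboolP Fw wmax.
set u := v iu in Fu umin *; set w := v iw in Fw wmax *.
have ut : dot z u < t by apply: le_lt_trans i0t; apply: umin.
have tw : t < dot z w by apply: lt_le_trans i1t _; apply: wmax.
have uw := lt_trans ut tw.
have utw : dot z u < t < dot z w by rewrite ut.
(* [d] is scaled to raise the height by 1, so that a point of the line is [x] plus its height above
   [t] times [d]. *)
pose d := (dot z w - t)^-1 *: (w - x).
have dw : w = x + (dot z w - t) *: d.
  rewrite scalerA mulfV ?scale1r; first by rewrite addrC subrK.
  by rewrite subr_eq0 gt_eqF.
clearbody d.
have dlt y : face_at y -> dot z y < t -> y = x + (dot z y - t) *: d.
  move=> Fy yt; have := face_at_cross Fy Fw; rewrite yt tw => /(_ isT) e.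
  have /eqP : (dot z w - t) *: (x - y) = (dot z w - t) *: ((t - dot z y) *: d).
    rewrite -e {1}dw addrAC subrr add0r !scalerA; congr (_ *: _); ring.
  rewrite -subr_eq0 -scalerBr scaler_eq0 !subr_eq0 gt_eqF //= => /eqP e'.
  by rewrite -opprB scaleNr -e' opprB addrC subrK.
(* A point above the plane is compared with [u], which is already on the line by [dlt]; a point in
   the plane is [x] itself. *)
have line y : face_at y -> y = x + (dot z y - t) *: d.
  move=> Fy; case: (ltgtP (dot z y) t) => [yt|yt|yt]; first exact: dlt.
    have := face_at_cross Fu Fy; rewrite yt ut => /(_ isT).
    move=> e.
    have /eqP : (t - dot z u) *: (y - x) = (t - dot z u) *: ((dot z y - t) *: d).
      rewrite e {1}(dlt _ Fu ut) opprD addrA subrr add0r -scaleNr !scalerA.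
      by congr (_ *: _); ring.
    rewrite -subr_eq0 -scalerBr scaler_eq0 !subr_eq0 gt_eqF //= => /eqP <-.
    by rewrite addrC subrK.
  by rewrite yt subrr scale0r addr0; apply: face_at_slice.
have xE : x = cross z t u w.
  rewrite /cross {2}(line _ Fw) {1 4}(line _ Fu).
  by apply/rowP => i; rewrite !mxE; field; rewrite subr_eq0 gt_eqF.
exists u, w; split=> //; split=> [| | |y y' s Py Py' s01 sq].
- by apply: contraTneq uw => ->; rewrite ltxx.
- by case: Fu.
- by case: Fw.
- have Fq : face_at (s *: y + (1 - s) *: y').
    have [r /andP[r0 r1] ->] := sq.
    have -> : u + r *: (w - u) = r *: w + (1 - r) *: u.
      by apply/rowP => i; rewrite !mxE; ring.
    by apply: face_at_cvx => //; rewrite r0.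
  have Fy := face_at_extreme s01 Py Py' Fq.
  have yb : dot z u <= dot z y <= dot z w.
    apply: face_at_dot Fy => i Fi.
    by apply/andP; split; [apply: umin|apply: wmax]; apply/asboolP.
  have -> : y = cross z (dot z y) u w.
    rewrite {1}(line _ Fy) /cross {2}(line _ Fw) {1 4}(line _ Fu).
    by apply/rowP => i; rewrite !mxE; field; rewrite subr_eq0 gt_eqF.
  exact: cross_seg.
Qed.

End SliceVertex.

(** * The average number of vertices as a sum over edges *)

Section StepIntegral.
Context {R : realType}.
Implicit Types (f : R -> R) (a b : R).
Local Notation mu := (@lebesgue_measure R).

(** Integrability travels with the value, since additivity of the integral requires it. *)
Definition has_integral a b f (y : R) : Prop :=
  mu.-integrable `[a, b] (EFin \o f) /\ \int[mu]_(t in `[a, b]) f t = y.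

Lemma has_integral_sum a b (I : eqType) (r : seq I) (F : I -> R -> R)
    (Y : I -> R) : (forall i, i \in r -> has_integral a b (F i) (Y i)) ->
  has_integral a b (fun t => \sum_(i <- r) F i t) (\sum_(i <- r) Y i).
Proof.
elim: r => [|i r IH] h.
  have -> : (fun t => \sum_(i <- [::]) F i t) = cst 0.
    by apply/funext => t; rewrite big_nil.
  by split; [exact: integrable0 | rewrite big_nil Rintegral_cst // mul0r].
have [iF eF] : has_integral a b (F i) (Y i) by apply: h; rewrite mem_head.
have [ir er] := IH (fun j jr => h j (mem_behead (s := i :: r) jr)).
have -> : (fun t => \sum_(j <- i :: r) F j t) =
    (fun t => F i t + \sum_(j <- r) F j t).
  by apply/funext => t; rewrite big_cons.
split; last by rewrite RintegralD // eF er big_cons.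
rewrite (_ : EFin \o _ =
  ((EFin \o F i) \+ (EFin \o (fun t => (\sum_(j <- r) F j t)%R)))%E) //.
exact: integrableD.
Qed.

Lemma has_integralZ a b (k : R) f y :
  has_integral a b f y -> has_integral a b (fun t => k * f t) (k * y).
Proof.
move=> [i e]; split; last by rewrite RintegralZl // e.
rewrite (_ : EFin \o _ = fun t => (k%:E * (EFin \o f) t)%E) //.
exact: integrableZl.
Qed.

(** The maximum with 0 covers empty intervals; through it an edge that does not ascend contributes
    nothing. *)
Lemma has_integral_itv a b (c d : R) (bc bd : bool) : a <= c -> d <= b ->
  has_integral a b \1_[set` Interval (BSide bc c) (BSide bd d)]
    (Num.max (d - c) 0).
Proof.
move=> ac db; split.
  by apply: (integrableS measurableT) (integrable_indic_itv _ _ _ _).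
rewrite /Rintegral integral_indic // setIidl; last first.
  move=> x /=; rewrite !in_itv /=; case: bc; case: bd => /= /andP[? ?];
  by apply/andP; split; lra.
rewrite [X in fine X](lebesgue_measure_itv (Interval (BSide bc c) _)) /= lte_fin.
case: ifPn => cd.
  by rewrite max_l // subr_ge0 ltW.
by rewrite max_r // subr_le0 leNgt.
Qed.

Lemma has_integral_pt a b (s : R) : a <= s <= b -> has_integral a b \1_[set s] 0.
Proof.
move=> /andP[as_ sb]; rewrite -set_itv1.
by have := has_integral_itv true false as_ sb; rewrite subrr maxxx.
Qed.

(** Integrability of [f] is inherited from [g]: on the interval, [f] is [g] plus a multiple of a
    point indicator for each exceptional value. *)
Lemma has_integral_ae a b f g y (N : seq R) : has_integral a b g y ->
  {in `[a, b], forall t, t \notin N -> f t = g t} -> has_integral a b f y.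
Proof.
move=> hg fg.
(* Duplicates are removed so that each exceptional point is corrected only once. *)
pose N' := [seq s <- undup N | a <= s <= b].
have hN s : s \in N' -> has_integral a b (fun t => (f s - g s) * \1_[set s] t) 0.
  rewrite mem_filter => /andP[sab _]; rewrite -(mulr0 (f s - g s)).
  exact/has_integralZ/has_integral_pt.
have [iN eN] := has_integral_sum hN; have [ig eg] := hg.
pose h t := g t + \sum_(s <- N') (f s - g s) * \1_[set s] t.
have fh : {in `[a, b]%classic, f =1 h}.
  move=> t; rewrite inE /= => tab; rewrite /h.
  have [tN|tN] := boolP (t \in N).
    have tN' : t \in N'.
      by rewrite mem_filter mem_undup tN andbT; move: tab; rewrite in_itv.
    rewrite (bigD1_seq t) ?filter_uniq ?undup_uniq //= indicE mem_set //.
    rewrite big1 ?addr0 ?mulr1 ?subrKC // => s st.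
    by rewrite indicE memNset ?mulr0 //= => /esym/eqP; rewrite (negPf st).
  rewrite big_seq big1 ?addr0 ?fg // => s.
  rewrite mem_filter mem_undup => /andP[_ sN].
  rewrite indicE memNset ?mulr0 //= => ts; move: tN; rewrite ts sN.
  by [].
have ih : mu.-integrable `[a, b] (EFin \o h).
  rewrite (_ : EFin \o h =
    ((EFin \o g) \+
     (EFin \o (fun t => (\sum_(s <- N') (f s - g s) * \1_[set s] t)%R)))%E) //.
  exact: integrableD.
split.
  apply: eq_integrable ih => // t tab.
  by rewrite /= fh.
transitivity (\int[mu]_(t in `[a, b]) h t); first exact: eq_Rintegral.
by rewrite RintegralD // eg eN big1 ?addr0.
Qed.

End StepIntegral.

(** * Integrating the vertex count over the heights *)

Section AverageEdges.
Context {R : realType}.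
Local Notation E := 'rV[R]_3.
Implicit Types (P : set E) (x y z u w : E).

Lemma tmin_attained P z x : P x -> (forall y, P y -> dot z x <= dot z y) ->
  tmin P z = dot z x.
Proof.
move=> Px xmin; apply/eqP; rewrite eq_le; apply/andP; split.
  by apply: ge_inf; [exists (dot z x) => _ [y Py <-]; apply: xmin | exists x].
apply: lb_le_inf; first by exists (dot z x), x.
by move=> _ [y Py <-]; apply: xmin.
Qed.

Lemma tmax_attained P z x : P x -> (forall y, P y -> dot z y <= dot z x) ->
  tmax P z = dot z x.
Proof.
move=> Px xmax; apply/eqP; rewrite eq_le; apply/andP; split.
  apply: ge_sup; first by exists (dot z x), x.
  by move=> _ [y Py <-]; apply: xmax.
apply: ub_le_sup; last by exists x.
by exists (dot z x) => _ [y Py <-]; apply: xmax.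
Qed.

Lemma continuous_dotr z : continuous (dot z).
Proof.
have cid : continuous (fun x : E => x) by move=> x; apply: cvg_id.
have cz : continuous (fun _ : E => z) by apply: cst_continuous.
exact: (continuous_dot cz cid).
Qed.

Lemma compact_tmin P z : compact P -> P !=set0 ->
  exists2 x, P x & tmin P z = dot z x /\ forall y, P y -> dot z x <= dot z y.
Proof.
move=> cP P0; have cf := continuous_subspaceT (A := P) (@continuous_dotr z).
have [x /set_mem Px xmin] := compact_EVT_min P0 cP cf.
have {}xmin y : P y -> dot z x <= dot z y by move=> Py; apply/xmin/mem_set.
by exists x => //; split=> //; apply: tmin_attained.
Qed.

Lemma compact_tmax P z : compact P -> P !=set0 ->
  exists2 x, P x & tmax P z = dot z x /\ forall y, P y -> dot z y <= dot z x.
Proof.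
move=> cP P0; have cf := continuous_subspaceT (A := P) (@continuous_dotr z).
have [x /set_mem Px xmax] := compact_EVT_max P0 cP cf.
have {}xmax y : P y -> dot z y <= dot z x by move=> Py; apply/xmax/mem_set.
by exists x => //; split=> //; apply: tmax_attained.
Qed.

Lemma interior_extent P z : compact P -> interior P !=set0 -> z != 0 ->
  tmin P z < tmax P z.
Proof.
move=> cP [x ix] z0; have Px : P x := interior_subset ix.
have P0 : P !=set0 by exists x.
have [a _ [-> amin]] := compact_tmin z cP P0.
have [b _ [-> bmax]] := compact_tmax z cP P0.
(* Moving an interior point slightly along [z] stays in [P] and raises its height by a positive
   multiple of the squared norm of [z]. *)
have : \forall e \near (0 : R)^'+, P (x + e *: z).
  have cf : (x + e *: z) @[e --> (0 : R)^'+] --> x.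
    rewrite -[X in _ --> X]addr0 -(scale0r z); apply: cvgD; first exact: cvg_cst.
    apply: cvgZr_tmp; apply: cvg_within.
  exact: cf ix.
move=> near_P.
have [e [e0 Pe]] : exists e : R, 0 < e /\ P (x + e *: z).
  near (0 : R)^'+ => e.
  by exists e; split; [near: e; exact: nbhs_right_gt | near: e].
have := bmax _ Pe; have := amin _ Px; rewrite dotDr dotZr => h1 h2.
have : 0 < e * dot z z by rewrite mulr_gt0 // dot_gt0.
lra.
Unshelve. all: by end_near. Qed.

Lemma exists_avoid (a b : R) (N : seq R) : a < b ->
  exists2 t, a < t < b & t \notin N.
Proof.
elim: N a b => [|s N IH] a b ab.
  by exists ((a + b) / 2); rewrite ?midf_lt // in_nil.
have [/andP[as_ sb]|] := boolP (a < s < b).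
  have [t /andP[at_ ts] tN] := IH _ _ as_; exists t.
    by rewrite at_ (lt_trans ts).
  by rewrite in_cons negb_or tN andbT lt_eqF.
move=> sN; have [t tab tN] := IH _ _ ab; exists t => //.
rewrite in_cons negb_or tN andbT; apply: contraNneq sN => <-.
exact: tab.
Qed.

Lemma nb_vertices_seq P (s : seq E) : uniq s ->
  (forall x, vertices P x <-> x \in s) -> nb_vertices P = size s.
Proof.
move=> us h; rewrite /nb_vertices (_ : vertices P = [set` [fset x in s]%fset]).
  by rewrite set_fsetK card_fseq undup_id.
by apply/seteqP; split=> x; rewrite /= inE => /h.
Qed.

Variables (m : nat) (v : 'I_m -> E) (K : seq (E * E)).
Local Notation P := (hull predT v).
Hypothesis Ku : uniq K.
Hypothesis KP : forall u w, (u, w) \in K <-> edge P u w.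

(** [cross] is a bijection from the edges ascending through height [t] to the vertices of the
    slice. *)
Lemma nb_vertices_slice z (t : R) : (forall i, dot z (v i) != t) ->
  nb_vertices (slice P z t) = count (fun p => dot z p.1 < t < dot z p.2) K.
Proof.
move=> tv; rewrite -size_filter.
set K' := [seq p <- K | _]; pose c p := cross z t p.1 p.2.
rewrite (@nb_vertices_seq _ [seq c p | p <- K']) ?size_map //.
- rewrite map_inj_in_uniq ?filter_uniq // => -[u w] [u' w'].
  rewrite !mem_filter /= => /andP[t1 /KP e1] /andP[t2 /KP e2].
  exact: (cross_inj e1 e2).
- move=> x; split=> [/(vertex_cross tv) [u [w [ed ut ->]]]|].
    by apply: (map_f c (x := (u, w))); rewrite mem_filter ut; apply/KP.
  move=> /mapP[[u w]]; rewrite mem_filter => /andP[tt /KP ed] ->.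
  by apply: cross_vertex => //; apply: hull_cvx.
Qed.

Lemma avg_vertices_edges z : P !=set0 -> tmin P z < tmax P z ->
  avg_vertices P z * (tmax P z - tmin P z) =
    \sum_(p <- K) Num.max (dot z p.2 - dot z p.1) 0.
Proof.
move=> P0 tt; have cP := @hull_compact _ _ predT v.
have [a Pa [aE amin]] := compact_tmin z cP P0.
have [b Pb [bE bmax]] := compact_tmax z cP P0.
rewrite /avg_vertices mulrAC mulVf ?mul1r; last by rewrite subr_eq0 gt_eqF.
suff [_ ->] : has_integral (tmin P z) (tmax P z)
  (fun t => (nb_vertices (slice P z t))%:R)
  (\sum_(p <- K) Num.max (dot z p.2 - dot z p.1) 0) by [].
(* The exceptional heights are those of the [v i]; elsewhere the count is the sum of the indicators
   of the height intervals of the edges. *)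
apply: (@has_integral_ae _ _ _ _
  (fun t => \sum_(p <- K) \1_(`]dot z p.1, dot z p.2[%classic) t) _
  [seq dot z (v i) | i <- enum 'I_m]).
  apply: has_integral_sum => -[u w] /KP[_ Pu Pw _] /=.
  by apply: has_integral_itv; rewrite ?aE ?bE ?amin ?bmax.
move=> t _ tN; rewrite nb_vertices_slice.
  rewrite -sum1_count natr_sum big_mkcond; apply: eq_bigr => p _.
  by rewrite indicE mem_setE in_itv /=; case: ifP.
move=> i; apply: contraNneq tN => <-.
by apply: (map_f (fun i => dot z (v i))); rewrite mem_enum.
Qed.

Lemma edges_swap : perm_eq K [seq (p.2, p.1) | p <- K].
Proof.
apply: uniq_perm => //.
  by rewrite map_inj_uniq // => -[u w] [u' w'] [-> ->].
move=> [u w]; apply/idP/mapP => [/KP/edge_sym/KP h|]; first by exists (w, u).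
by move=> [[u' w'] /KP/edge_sym/KP h [-> ->]].
Qed.

(** Reversing all edges permutes [K], so the ascending and the descending parts have equal sums. *)
Lemma sum_edges_norm z : \sum_(p <- K) Num.max (dot z p.2 - dot z p.1) 0 =
  2^-1 * \sum_(p <- K) `|dot z (p.2 - p.1)|.
Proof.
have h : \sum_(p <- K) Num.max (dot z p.2 - dot z p.1) 0 =
    \sum_(p <- K) Num.max (dot z p.1 - dot z p.2) 0.
  by rewrite (perm_big _ edges_swap) big_map.
suff : \sum_(p <- K) Num.max (dot z p.2 - dot z p.1) 0 +
    \sum_(p <- K) Num.max (dot z p.1 - dot z p.2) 0 =
    \sum_(p <- K) `|dot z (p.2 - p.1)| by move=> <-; rewrite -h; field.
rewrite -big_split; apply: eq_bigr => p _ /=; rewrite dotBr.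
case: (leP (dot z p.1) (dot z p.2)) => pp.
  by rewrite max_l ?subr_ge0 // max_r ?subr_le0 // addr0 ger0_norm ?subr_ge0.
by rewrite max_r ?subr_le0 1?ltW // max_l ?subr_ge0 1?ltW // add0r
  ltr0_norm ?subr_lt0 // opprB.
Qed.

(** This will make [lambda] positive. A slice at a height avoiding all [v i] is compact and
    nonempty, so it has a vertex, and this vertex lies on an ascending edge. *)
Lemma sum_edges_gt0 z : P !=set0 -> tmin P z < tmax P z ->
  0 < \sum_(p <- K) Num.max (dot z p.2 - dot z p.1) 0.
Proof.
move=> P0 tt; have cP := @hull_compact _ _ predT v.
have [a Pa [aE amin]] := compact_tmin z cP P0.
have [b Pb [bE bmax]] := compact_tmax z cP P0.
have [t tab tN] := exists_avoid [seq dot z (v i) | i <- enum 'I_m] tt.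
have tv i : dot z (v i) != t.
  apply: contraNneq tN => <-.
  by apply: (map_f (fun i => dot z (v i))); rewrite mem_enum.
have ab : dot z a < dot z b by rewrite -aE -bE.
rewrite aE bE in tab.
have S0 : slice P z t !=set0.
  exists (cross z t a b); split; last by rewrite /= dot_cross // lt_eqF.
  have [s /andP[s0 s1] ->] := crossE tab.
  by apply: hull_cvx => //; rewrite !ltW.
have cS : compact (slice P z t).
  apply: compact_closedI => //.
  have := @preimage_closed _ _ (dot z) [set x | x = t].
  by apply=> [x _|]; [apply: continuous_dotr|apply: closed_eq].
have [x /(vertex_cross tv) [u [w [/KP ed /andP[ut tw] _]]]] :=
  compact_vertex cS S0.
rewrite (bigD1_seq (u, w)) //=; apply: ltr_pwDl.
  by rewrite lt_max subr_gt0 (lt_trans ut tw).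
by apply: sumr_ge0 => p _; rewrite le_max lexx orbT.
Qed.

End AverageEdges.

(** * Edges of zonotopes *)

Lemma free_pairP {R : realType} (x y : 'rV[R]_3) : free [:: x; y] <->
  forall k l : R, k *: x + l *: y = 0 -> k = 0 /\ l = 0.
Proof.
rewrite free_cons seq1_free span_seq1; split=> [/andP[xy y0] k l e|h].
  have k0 : k = 0.
    apply/eqP; apply: contraNT xy => k0; apply/vlineP; exists (- (k^-1 * l)).
    rewrite scaleNr -scalerA; apply/eqP; rewrite -addr_eq0.
    by rewrite -[X in X + _](scalerK k0) -scalerDr e scaler0.
  split=> //; move: e; rewrite k0 scale0r add0r => /eqP.
  by rewrite scaler_eq0 (negPf y0) orbF => /eqP.
have y0 : y != 0.
  apply/eqP => y0; have [|_ /eqP] := h 0 1; first by rewrite y0 scale0r scaler0 addr0.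
  by rewrite oner_eq0.
rewrite y0 andbT; apply/vlineP => -[k xE].
have [|/eqP] := h 1 (- k); first by rewrite scale1r xE scaleNr subrr.
by rewrite oner_eq0.
Qed.

Section Zonotope.
Context {R : realType}.
Local Notation E := 'rV[R]_3.
Variables (n : nat) (c : E) (a : 'I_n -> E).
Implicit Types (t : 'I_n -> R) (z x u w : E) (i j k : 'I_n).

Definition box t := forall i, 0 <= t i <= 1.

Definition zpoint t : E := c + \sum_i t i *: a i.

(** The zonotope as an image of the cube. A point may have several parameter vectors, so the
    arguments about edges start from chosen ones. *)
Definition zono : set E := zpoint @` box.

Lemma translate_zonotope : translate c (zonotope a) = zono.
Proof.
apply/seteqP; split=> x.
  move=> [_ [y yP <-] <-].
  have /choice[t tP] i : exists s, 0 <= s <= 1 /\ y i = s *: a i.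
    by have [s] := yP i; rewrite /= in_itv /= => s01 <-; exists s.
  exists t; first by move=> i; case: (tP i).
  by congr (_ + _); apply: eq_bigr => i _; case: (tP i) => _ ->.
move=> [t tb <-]; exists (\sum_i t i *: a i) => //.
exists (fun i => t i *: a i) => // i.
by exists (t i) => //=; rewrite in_itv /= tb.
Qed.

Lemma zpoint_comb (s : R) t t' : s *: zpoint t + (1 - s) *: zpoint t' =
  zpoint (fun i => s * t i + (1 - s) * t' i).
Proof.
rewrite /zpoint !scalerDr addrACA -scalerDl addrC subrKC scale1r addrC.
congr (_ + _); rewrite !scaler_sumr -big_split; apply: eq_bigr => i _ /=.
by rewrite !scalerA scalerDl.
Qed.

Lemma eq_zpoint t t' : t =1 t' -> zpoint t = zpoint t'.
Proof. by move=> tt; congr (_ + _); apply: eq_bigr => i _; rewrite tt. Qed.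

Lemma zono_cvx : cvx zono.
Proof.
move=> _ _ s [t tb <-] [t' tb' <-] /andP[s0 s1].
rewrite zpoint_comb; exists (fun i => s * t i + (1 - s) * t' i) => // i.
have /andP[l1 h1] := tb i; have /andP[l2 h2] := tb' i.
have s1' : 0 <= 1 - s by lra.
have := mulr_ge0 s0 l1; have := mulr_ge0 s1' l2.
have := ler_wpM2l s0 h1; have := ler_wpM2l s1' h2.
by move=> *; apply/andP; split; lra.
Qed.

Lemma zono_nonempty : zono !=set0.
Proof. by exists (zpoint (fun=> 0)), (fun=> 0) => // i; rewrite lexx ler01. Qed.

Lemma zono_compact : compact zono.
Proof.
have cbox : compact [set r : 'rV[R]_n | forall i, `[0, 1]%classic (r 0 i)].
  exact (@rV_compact R n (fun=> `[0, 1]%classic)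
    (fun=> @segment_compact _ _ _)).
have -> : zono = (fun r => c + lincomb a r) @`
    [set r : 'rV[R]_n | forall i, `[0, 1]%classic (r 0 i)].
  apply/seteqP; split=> _ [t tb <-].
    exists (\row_i t i); first by move=> i /=; rewrite mxE in_itv /= tb.
    by congr (_ + _); apply: eq_bigr => i _; rewrite mxE.
  by exists (t 0) => // i; have := tb i; rewrite /= in_itv.
apply: continuous_compact => //; apply: continuous_subspaceT => r.
exact: (cvgD (cvg_cst c) (@continuous_lincomb _ _ _ r)).
Qed.

Lemma dot_zpoint z t : dot z (zpoint t) = dot z c + \sum_i t i * dot z (a i).
Proof.
by rewrite dotDr dot_sumr; congr (_ + _); apply: eq_bigr => i _; rewrite dotZr.
Qed.

Lemma zono_tmin z :
  tmin zono z = dot z c + \sum_i Num.min (dot z (a i)) 0.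
Proof.
pose t i : R := (dot z (a i) < 0)%R%:R.
have tmul i : t i * dot z (a i) = Num.min (dot z (a i)) 0.
  by rewrite /t; case: ltP => h; rewrite ?mul1r ?mul0r.
have tb : box t by move=> i; rewrite /t; case: (_ < _); rewrite lexx ler01.
have e : dot z (zpoint t) = dot z c + \sum_i Num.min (dot z (a i)) 0.
  by rewrite dot_zpoint; congr (_ + _); apply: eq_bigr.
rewrite -e; apply: tmin_attained; first by exists t.
move=> _ [t' tb' <-]; rewrite e dot_zpoint lerD2l; apply: ler_sum => i _.
have /andP[t0 t1] := tb' i; case: (ltP (dot z (a i)) 0) => h; last exact: mulr_ge0.
by rewrite -subr_ge0 -[X in _ - X]mul1r -mulrBl mulr_le0 ?subr_le0 // ltW.
Qed.

Lemma zono_tmax z :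
  tmax zono z = dot z c + \sum_i Num.max (dot z (a i)) 0.
Proof.
pose t i : R := (0 < dot z (a i))%R%:R.
have tmul i : t i * dot z (a i) = Num.max (dot z (a i)) 0.
  rewrite /t; case: ltP => h; rewrite ?mul1r ?mul0r ?max_l ?max_r ?ltW //.
have tb : box t by move=> i; rewrite /t; case: (_ < _); rewrite lexx ler01.
have e : dot z (zpoint t) = dot z c + \sum_i Num.max (dot z (a i)) 0.
  by rewrite dot_zpoint; congr (_ + _); apply: eq_bigr.
rewrite -e; apply: tmax_attained; first by exists t.
move=> _ [t' tb' <-]; rewrite e dot_zpoint lerD2l; apply: ler_sum => i _.
have /andP[t0 t1] := tb' i; case: (leP 0 (dot z (a i))) => h.
  by rewrite ler_piMl.
by rewrite mulr_ge0_le0 // ltW.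
Qed.

Lemma zono_extent z : tmax zono z - tmin zono z = \sum_i `|dot z (a i)|.
Proof.
rewrite zono_tmin zono_tmax opprD addrACA subrr add0r -sumrB.
apply: eq_bigr => i _; case: (leP 0 (dot z (a i))) => h.
  by rewrite subr0 ger0_norm.
by rewrite sub0r ltr0_norm.
Qed.

Hypothesis nc : pairwise_noncollinear a.

Lemma noncol_coef i j (k l : R) : i != j -> k *: a i + l *: a j = 0 ->
  k = 0 /\ l = 0.
Proof. by move=> /nc/free_pairP; apply. Qed.

Definition upd t k (s : R) : 'I_n -> R := fun j => if j == k then s else t j.

Lemma zpoint_upd t k (s : R) : zpoint (upd t k s) = zpoint t + (s - t k) *: a k.
Proof.
rewrite /zpoint [in LHS](bigD1 k) // [in RHS](bigD1 k) //= /upd eqxx.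
rewrite (eq_bigr (fun i => t i *: a i)) => [|i /negPf -> //].
by apply/rowP => i; rewrite !mxE; ring.
Qed.

Lemma box_upd t k (s : R) : box t -> 0 <= s <= 1 -> box (upd t k s).
Proof. by move=> tb s01 j; rewrite /upd; case: ifP. Qed.

(** A fractional coordinate writes the point as a mixture of two points of the zonotope that differ
    by [a k]; extremeness puts both on the segment, which makes [a k] parallel to it. *)
Lemma edge_coord u w t k : edge zono u w -> box t -> 0 < t k < 1 ->
  seg u w (zpoint t) -> seg u w (zpoint (upd t k 0)) /\ seg u w (zpoint (upd t k 1)).
Proof.
move=> ed tb tk st.
have Z0 : zono (zpoint (upd t k 0)).
  by exists (upd t k 0) => //; apply: box_upd => //; rewrite lexx ler01.
have Z1 : zono (zpoint (upd t k 1)).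
  by exists (upd t k 1) => //; apply: box_upd => //; rewrite lexx ler01.
have st' : seg u w (t k *: zpoint (upd t k 1) + (1 - t k) *: zpoint (upd t k 0)).
  rewrite zpoint_comb -(@eq_zpoint t) // => j.
  by rewrite /upd; case: eqP => [->|_]; ring.
have [_ _ _ h] := ed.
split; [exact: (edge_swap ed Z1 Z0 tk st')|exact: (h _ _ _ Z1 Z0 tk st')].
Qed.

Lemma edge_generator u w : edge zono u w -> exists i t,
  [/\ box t, forall j, j != i -> t j = 0 \/ t j = 1, t i = 0
    & (u = zpoint t /\ w = zpoint t + a i) \/
      (w = zpoint t /\ u = zpoint t + a i)].
Proof.
move=> ed; have [uw [tu bu uE] [tw bw wE] _] := ed.
(* Parameters of the midpoint: a coordinate in which the two ends differ is fractional here. *)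
pose tm j := 2^-1 * tu j + (1 - 2^-1) * tw j.
have bm : box tm.
  by move=> j; have /andP[? ?] := bu j; have /andP[? ?] := bw j;
    apply/andP; rewrite /tm; split; lra.
have sm : seg u w (zpoint tm).
  rewrite -zpoint_comb uE wE; exists 2^-1; first by apply/andP; split; lra.
  by apply/rowP => k; rewrite !mxE; field.
have [i tui] : exists i, tu i != tw i.
  apply/existsP; apply: contraNT uw; rewrite negb_exists => /forallP h.
  by rewrite -uE -wE (@eq_zpoint tu tw) // => j; apply/eqP; have := h j; rewrite negbK.
have inner j : tu j != tw j -> 0 < tm j < 1.
  have /andP[? ?] := bu j; have /andP[? ?] := bw j.
  by rewrite /tm neq_lt => /orP[?|?]; apply/andP; split; lra.
have [] := edge_coord ed bm (inner i tui) sm.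
rewrite !zpoint_upd => -[r0 r0P p0] [r1 r1P p1].
have ai : a i = (r1 - r0) *: (w - u).
  have -> : (r1 - r0) *: (w - u) = (u + r1 *: (w - u)) - (u + r0 *: (w - u)).
    by apply/rowP => k; rewrite !mxE; ring.
  by rewrite -p0 -p1; apply/rowP => k; rewrite !mxE; ring.
(* A second fractional coordinate would make [a j] parallel to the edge too, hence collinear with
   [a i]. *)
have tmj j : j != i -> tm j = 0 \/ tm j = 1.
  move=> ji; have [tj|] := boolP (0 < tm j < 1); last first.
    have /andP[? ?] := bm j; rewrite negb_and -!leNgt.
    by case/orP => ?; [left|right]; lra.
  have [] := edge_coord ed bm tj sm.
  rewrite !zpoint_upd => -[s0 _ q0] [s1 _ q1].
  have aj : a j = (s1 - s0) *: (w - u).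
    have -> : (s1 - s0) *: (w - u) = (u + s1 *: (w - u)) - (u + s0 *: (w - u)).
      by apply/rowP => k; rewrite !mxE; ring.
    by rewrite -q0 -q1; apply/rowP => k; rewrite !mxE; ring.
  have [|s10 r10] := @noncol_coef j i (r1 - r0) (- (s1 - s0)) ji.
    by rewrite ai aj !scalerA -scalerDl (_ : _ + _ = 0) ?scale0r //; ring.
  have a0 : a i = 0 by rewrite ai s10 scale0r.
  have [||/eqP] := @noncol_coef i j 1 0; first by rewrite eq_sym.
  - by rewrite a0 scaler0 scale0r addr0.
  by rewrite oner_eq0.
have tmu j : j != i -> tu j = tm j /\ tw j = tm j.
  have /andP[? ?] := bu j; have /andP[? ?] := bw j.
  by move=> /tmj; rewrite /tm => -[h|h]; split; lra.
exists i, (upd tm i 0).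
have ui : u = zpoint (upd tm i 0) + tu i *: a i.
  rewrite -uE (_ : zpoint tu = zpoint (upd (upd tm i 0) i (tu i))).
    by rewrite zpoint_upd /upd eqxx subr0.
  apply: eq_zpoint => j; rewrite /upd; case: eqP => [-> //|/eqP ji].
  by case: (tmu j ji).
have wi : w = zpoint (upd tm i 0) + tw i *: a i.
  rewrite -wE (_ : zpoint tw = zpoint (upd (upd tm i 0) i (tw i))).
    by rewrite zpoint_upd /upd eqxx subr0.
  apply: eq_zpoint => j; rewrite /upd; case: eqP => [-> //|/eqP ji].
  by case: (tmu j ji).
have ai0 : a i != 0.
  apply: contraNneq uw => ai0; rewrite ui wi ai0 !scaler0; exact: eqxx.
have e0 : tu i + r0 * (tw i - tu i) = 0.
  have /eqP : (tu i + r0 * (tw i - tu i)) *: a i = 0.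
    move: p0; rewrite -zpoint_upd ui wi.
    move: (zpoint (upd tm i 0)) => p /rowP e; apply/rowP => k.
    by have := e k; rewrite !mxE; lra.
  by rewrite scaler_eq0 (negPf ai0) orbF => /eqP.
have e1 : tu i + r1 * (tw i - tu i) = 1.
  have /eqP : (tu i + r1 * (tw i - tu i) - 1) *: a i = 0.
    have := p1; rewrite -zpoint_upd (_ : zpoint (upd tm i 1) = zpoint (upd tm i 0) + a i).
      rewrite ui wi.
      move: (zpoint (upd tm i 0)) => p /rowP e; apply/rowP => k.
      by have := e k; rewrite !mxE; lra.
    rewrite !zpoint_upd; apply/rowP => k; rewrite !mxE; ring.
  by rewrite scaler_eq0 (negPf ai0) orbF subr_eq0 => /eqP.
split.
- by apply: box_upd => //; rewrite lexx ler01.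
- by move=> j ji; rewrite /upd (negPf ji); apply: tmj.
- by rewrite /upd eqxx.
(* Both 0 and 1 are convex combinations of [tu i] and [tw i], which lie in [0, 1]; so one of them is
   0 and the other is 1. *)
- have /andP[u0 u1] := bu i; have /andP[w0 w1] := bw i.
  have /andP[? ?] := r0P; have /andP[? ?] := r1P.
  have h1 : 0 <= (1 - r0) * tu i by rewrite mulr_ge0 // subr_ge0.
  have h2 : 0 <= r0 * tw i by rewrite mulr_ge0.
  have h3 : 0 <= (1 - r1) * (1 - tu i) by rewrite mulr_ge0 ?subr_ge0.
  have h4 : 0 <= r1 * (1 - tw i) by rewrite mulr_ge0 ?subr_ge0.
  have /eqP : (1 - r0) * tu i = 0 by lra.
  rewrite mulf_eq0 => /orP[/eqP r0E|/eqP tu0].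
    have tw0 : tw i = 0 by nra.
    have r1E : r1 = 0 by nra.
    have tu1 : tu i = 1 by nra.
    by right; rewrite ui wi tw0 tu1 scale0r scale1r addr0.
  have r1E : r1 = 1 by nra.
  have tw1 : tw i = 1 by nra.
  by left; rewrite ui wi tu0 tw1 scale0r scale1r addr0.
Qed.

End Zonotope.

(** * The cross product in three dimensions *)

Section CrossProduct.
Context {R : realType}.
Local Notation E := 'rV[R]_3.
Implicit Types x y z : E.

Let i0 : 'I_3 := ord0.
Let i1 : 'I_3 := lift ord0 ord0.
Let i2 : 'I_3 := lift ord0 (lift ord0 ord0).

Definition crossp x y : E := \row_(k < 3)
  match val k with
  | 0 => x 0 i1 * y 0 i2 - x 0 i2 * y 0 i1
  | 1 => x 0 i2 * y 0 i0 - x 0 i0 * y 0 i2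
  | _ => x 0 i0 * y 0 i1 - x 0 i1 * y 0 i0
  end.

Let dotE x y : dot x y = x 0 i0 * y 0 i0 + x 0 i1 * y 0 i1 + x 0 i2 * y 0 i2.
Proof. by rewrite /dot !big_ord_recl big_ord0 addr0 addrA. Qed.

Let eq_row3 x y : x 0 i0 = y 0 i0 -> x 0 i1 = y 0 i1 -> x 0 i2 = y 0 i2 -> x = y.
Proof.
move=> h0 h1 h2; apply/rowP => -[[|[|[|//]]] ik].
- by rewrite (_ : Ordinal ik = i0) //; apply: val_inj.
- by rewrite (_ : Ordinal ik = i1) //; apply: val_inj.
- by rewrite (_ : Ordinal ik = i2) //; apply: val_inj.
Qed.

Lemma crossp_gram x y z : dot (crossp x y) (crossp x y) *: z =
  dot z (crossp x y) *: crossp x y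
  + (dot z x * dot y y - dot z y * dot x y) *: x
  + (dot z y * dot x x - dot z x * dot x y) *: y.
Proof. by apply: eq_row3; rewrite !dotE !mxE /=; ring. Qed.

Lemma dot_crosspl x y : dot (crossp x y) x = 0.
Proof. by rewrite dotE !mxE /=; ring. Qed.

Lemma dot_crosspr x y : dot (crossp x y) y = 0.
Proof. by rewrite dotE !mxE /=; ring. Qed.

Lemma crossp_eq0 x y : crossp x y = 0 -> dot x x *: y = dot x y *: x.
Proof.
move=> e; have h : crossp x (crossp x y) = dot x y *: x - dot x x *: y.
  by apply: eq_row3; rewrite !mxE /= !dotE; ring.
apply/eqP; rewrite eq_sym -subr_eq0 -h e.
by apply/eqP/eq_row3; rewrite !mxE /= !mulr0 subrr.
Qed.

End CrossProduct.

(** * Counting the cells of a line arrangement through the origin *)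

Section Cells.
Context {R : realType}.
Local Notation E := 'rV[R]_3.
Variables (n : nat) (a : 'I_n -> E).
Hypothesis nc : pairwise_noncollinear a.
Implicit Types (x z v : E) (i j k : 'I_n) (r : seq 'I_n) (J : {set 'I_n}).

(** For a generic vector no sign is zero, so this set is its whole sign vector. *)
Definition positive_part x r : {set 'I_n} := [set k | (k \in r) && (0 < dot x (a k))].

Definition generic x r : Prop := forall k, k \in r -> dot x (a k) != 0.

(* The cells cut out in the plane orthogonal to [a i] by the lines orthogonal
   to the [a j], [j \in r], each given by its sign vector. *)
Definition cells i r : {set {set 'I_n}} := [set J | `[< exists z,
  [/\ dot z (a i) = 0, generic z r & J = positive_part z r] >]].

Lemma cellsP i r J : reflect (exists z,
  [/\ dot z (a i) = 0, generic z r & J = positive_part z r]) (J \in cells i r).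
Proof. by rewrite inE; apply: asboolP. Qed.

Lemma generic_perturb x v r : generic x r -> exists2 e : R, 0 < e &
  forall s, `|s| <= e -> generic (x + s *: v) r /\
    positive_part (x + s *: v) r = positive_part x r.
Proof.
move=> gx; suff [e e0 he] : exists2 e : R, 0 < e & forall s, `|s| <= e ->
    forall k, k \in r -> dot (x + s *: v) (a k) != 0 /\
      (0 < dot (x + s *: v) (a k)) = (0 < dot x (a k)).
  exists e => // s /he h; split; first by move=> k /h[].
  by apply/setP => k; rewrite !inE; case: (boolP (k \in r)) => //= /h[_ ->].
elim: r gx => [|k r IH] gx; first by exists 1.
have [|e e0 he] := IH; first by move=> j jr; apply: gx; rewrite in_cons jr orbT.
have xk0 : 0 < `|dot x (a k)| by rewrite normr_gt0 gx // mem_head.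
have v1 : 0 < 1 + `|dot v (a k)| by rewrite ltr_pwDl.
(* The summand 1 keeps the denominator positive, and the halving makes the perturbation strictly
   smaller than the product whose sign must survive. *)
pose e' := `|dot x (a k)| / (1 + `|dot v (a k)|) / 2.
have e'0 : 0 < e' by rewrite !divr_gt0.
exists (Num.min e e'); first by rewrite lt_min e0.
move=> s; rewrite le_min => /andP[se se'] j.
rewrite in_cons => /predU1P[->|jr]; last exact: he.
have : `|s * dot v (a k)| < `|dot x (a k)|.
  rewrite normrM; apply: le_lt_trans (_ : e' * (1 + `|dot v (a k)|) < _).
    by rewrite ler_pM // lerDr.
  by rewrite /e' mulrAC divfK ?gt_eqF // ltr_pdivrMr // mulr_natr mulr2n ltrDl.
rewrite dotDl dotZl; move: (s * _) (dot x (a k)) => p q.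
case: (ltrgt0P q) => q0; rewrite ?ltr_norml ?normr0 => h.
- by case/andP: h => ? ?; split; [rewrite gt_eqF //; lra | apply/idP; lra].
- by case/andP: h => ? ?; split;
    [rewrite lt_eqF //; lra | apply/negbTE; rewrite -leNgt; lra].
- by have := normr_ge0 p; lra.
Qed.

Lemma gen_neq0 i j : i != j -> a i != 0.
Proof.
move=> ij; apply/eqP => ai0; have [|/eqP] := @noncol_coef _ _ _ nc i j 1 0 ij.
  by rewrite ai0 scaler0 scale0r addr0.
by rewrite oner_eq0.
Qed.

Lemma crossp_gen_neq0 i j : i != j -> crossp (a i) (a j) != 0.
Proof.
move=> ij; apply/eqP => /crossp_eq0 e.
have [|_ /eqP] := @noncol_coef _ _ _ nc i j (- dot (a i) (a j)) (dot (a i) (a i)) ij.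
  by rewrite e -scalerDl addNr scale0r.
by rewrite dot_eq0 (negPf (gen_neq0 ij)).
Qed.

Lemma ortho_witness i j : i != j ->
  exists2 v, dot v (a i) = 0 & 0 < dot v (a j).
Proof.
move=> ij; have i0 := gen_neq0 ij.
(* The component of [a j] orthogonal to [a i], multiplied by the squared norm of [a i]. *)
pose v := dot (a i) (a i) *: a j - dot (a i) (a j) *: a i.
have vi : dot v (a i) = 0.
  by rewrite dotBl !dotZl (dotC (a j)); ring.
have v0 : v != 0.
  apply/eqP => e; have [|_ /eqP] := @noncol_coef _ _ _ nc i j
    (- dot (a i) (a j)) (dot (a i) (a i)) ij.
    by rewrite -e addrC scaleNr.
  by rewrite dot_eq0 (negPf i0).
exists v => //; have : 0 < dot v v by rewrite dot_gt0.
rewrite {2}/v dotBr !dotZr vi mulr0 subr0 pmulr_rgt0 //.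
by rewrite dot_gt0.
Qed.

(** Within the plane orthogonal to [a i], the line orthogonal to [a j] is the orthogonal complement
    of this span, so distinct spans stand for distinct lines. *)
Definition plane i j : {vspace E} := <<[:: a i; a j]>>%VS.

Lemma mem_planeP i j x :
  reflect (exists k l : R, x = k *: a i + l *: a j) (x \in plane i j).
Proof.
rewrite /plane span_cons span_seq1; apply: (iffP memv_addP).
  by move=> [_ /vlineP[k ->] [_ /vlineP[l ->] ->]]; exists k, l.
by move=> [k [l ->]]; exists (k *: a i); [|exists (l *: a j)];
  rewrite ?memvZ ?memv_line.
Qed.

Lemma dim_plane i j : i != j -> \dim (plane i j) = 2%N.
Proof. by move=> /nc; rewrite /free => /eqP. Qed.

Lemma plane_gen i j k : i != k -> i != j ->
  (plane i j == plane i k) = (a j \in plane i k).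
Proof.
move=> ik ij; apply/eqP/idP => [<-|h].
  by apply: memv_span; rewrite !inE eqxx orbT.
apply/eqP; rewrite eqEdim !dim_plane // leqnn andbT.
apply/span_subvP => x; rewrite !inE => /orP[/eqP ->|/eqP -> //].
by apply: memv_span; rewrite !inE eqxx.
Qed.

Lemma cells_nil i : cells i [::] = [set finset.set0]%SET.
Proof.
apply/setP => J; rewrite finset.in_set1; apply/cellsP/eqP => [[z [_ _ ->]]|->].
  by apply/setP => k; rewrite !inE.
by exists 0; split; [rewrite dot0l| |apply/setP => k; rewrite !inE].
Qed.

Lemma cells_sub i r J k : J \in cells i r -> k \in J -> k \in r.
Proof. by move=> /cellsP[z [_ _ ->]]; rewrite inE => /andP[]. Qed.

Lemma positive_part_cons z j r : positive_part z (j :: r) =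
  if 0 < dot z (a j) then j |: positive_part z r
  else positive_part z r :\ j.
Proof.
apply/setP => k; rewrite inE in_cons; case: ifPn => h; rewrite !inE.
  by case: eqP => [->|_] /=; rewrite ?h.
by case: eqP => [->|_] //=; rewrite (negPf h).
Qed.

Lemma setD1_notin j J : j \notin J -> J :\ j = J.
Proof.
by move=> jJ; apply/setP => k; rewrite !inE; case: eqP => // ->; apply/esym/negbTE.
Qed.

Lemma positive_part_notin z j r : j \notin r -> j \notin positive_part z r.
Proof. by move=> jr; rewrite inE (negPf jr). Qed.

(** On vectors orthogonal to [a i], the product with [a j] is a fixed nonzero multiple of the
    product with some [a k] from [r], so the sign at [j] is already determined. *)
Lemma card_cells_old i j r : i != j -> i \notin r -> j \notin r ->
  plane i j \in [seq plane i k | k <- r] -> #|cells i (j :: r)| = #|cells i r|.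
Proof.
move=> ij ir jr /mapP[k kr].
have ik : i != k by apply: contraNneq ir => ->.
move/eqP; rewrite plane_gen // => /mem_planeP[al [be ajE]].
have be0 : be != 0.
  apply/eqP => be0; have [|_ /eqP] := @noncol_coef _ _ _ nc i j al (-1) ij.
    by rewrite ajE be0 scale0r addr0 scaleN1r subrr.
  by rewrite oppr_eq0 oner_eq0.
pose phi J := if (k \in J) == (0 < be) then j |: J else J.
have phiE z : dot z (a i) = 0 -> dot z (a k) != 0 ->
    dot z (a j) != 0 /\
    positive_part z (j :: r) = phi (positive_part z r).
  move=> zi zk; have zj : dot z (a j) = be * dot z (a k).
    by rewrite ajE dotDr !dotZr zi mulr0 add0r.
  split; first by rewrite zj mulf_neq0.
  rewrite positive_part_cons /phi inE kr /= zj.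
  have -> : (0 < be * dot z (a k)) = ((0 < dot z (a k)) == (0 < be)).
    have [b0|b0|b0] := ltrgt0P be; last by rewrite b0 eqxx in be0.
      by rewrite pmulr_rgt0 // eqb_id.
    rewrite nmulr_rgt0 // lt_neqAle zk /= leNgt.
    by case: (0 < dot z (a k)).
  by case: ifP => // _; apply: setD1_notin; apply: positive_part_notin.
have -> : cells i (j :: r) = [set phi J | J in cells i r]%SET.
  apply/setP => J; apply/cellsP/imsetP.
    move=> [z [zi gz ->]]; exists (positive_part z r).
      by apply/cellsP; exists z; split=> // l lr; apply: gz; rewrite in_cons lr orbT.
    by apply: (phiE z zi _).2; apply: gz; rewrite in_cons kr orbT.
  move=> [_ /cellsP[z [zi gz ->]] ->]; have [zj zE] := phiE z zi (gz k kr).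
  exists z; split=> // l; rewrite in_cons => /predU1P[-> //|]; exact: gz.
apply: card_in_imset => J J' Jc J'c.
have phiK L : L \in cells i r -> phi L :\ j = L.
  move=> Lc; have jL : j \notin L by apply: contra jr; apply: cells_sub Lc.
  rewrite /phi; case: ifP => _; first by rewrite finset.setU1K.
  by apply: setD1_notin.
by move=> e; rewrite -(phiK J) // e phiK.
Qed.

(** The new line splits exactly the cells it meets: the two around its opposite rays, or the whole
    plane as a single cell when [r] is empty. *)
Lemma card_cells_new i j r : i != j -> i \notin r -> j \notin r ->
  plane i j \notin [seq plane i k | k <- r] ->
  #|cells i (j :: r)| = (#|cells i r| + (r != [::]).+1)%N.
Proof.
move=> ij ir jr pj; have [v vi vj] := ortho_witness ij.
pose side (Q : pred R) : {set {set 'I_n}} := [set J | `[< exists z,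
  [/\ dot z (a i) = 0, generic z r, J = positive_part z r & Q (dot z (a j))] >]]%SET.
have sideP (Q : pred R) J : reflect (exists z, [/\ dot z (a i) = 0, generic z r,
    J = positive_part z r & Q (dot z (a j))]) (J \in side Q).
  by rewrite inE; apply: asboolP.
pose T := side (fun y => 0 < y); pose F := side (fun y => y < 0).
have notin (Q : pred R) J : J \in side Q -> j \notin J.
  by move=> /sideP[z [_ _ -> _]]; apply: positive_part_notin.
have cE : cells i (j :: r) = [set j |: J | J in T]%SET :|: F.
  apply/setP => J; rewrite finset.in_setU; apply/cellsP/orP.
    move=> [z [zi gz ->]]; have zj : dot z (a j) != 0 by apply: gz; rewrite mem_head.
    have gz' : generic z r by move=> l lr; apply: gz; rewrite in_cons lr orbT.
    rewrite positive_part_cons; case: (ltrgt0P (dot z (a j))) => zj'.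
    - by left; apply/imset_f/sideP; exists z.
    - right; apply/sideP; exists z; split=> //.
      by apply: setD1_notin; apply: positive_part_notin.
    - by rewrite zj' eqxx in zj.
  case=> [/imsetP[_ /sideP[z [zi gz -> zj]] ->]|/sideP[z [zi gz -> zj]]].
    exists z; split=> //; last by rewrite positive_part_cons zj.
    by move=> l; rewrite in_cons => /predU1P[->|/gz //]; rewrite gt_eqF.
  exists z; split=> //.
    by move=> l; rewrite in_cons => /predU1P[->|/gz //]; rewrite lt_eqF.
  rewrite positive_part_cons ltNge ltW //=; apply/esym/setD1_notin.
  exact: positive_part_notin.
have -> : #|cells i (j :: r)| = (#|T| + #|F|)%N.
  rewrite cE cardsU card_in_imset => [|J J' /notin h /notin h' e].
    rewrite (_ : _ :&: F = finset.set0) ?cards0 ?subn0 //; apply/setP => J.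
    rewrite finset.in_setI finset.in_set0; apply/negbTE/andP.
    by move=> -[/imsetP[L _ ->] /notin]; rewrite finset.setU11.
  by rewrite -(finset.setU1K h) e finset.setU1K.
(* The union of [T] and [F] consists of all old cells, and their intersection of the cells met by
   the new line. *)
rewrite -cardsUI; congr (_ + _)%N.
  congr #|pred_of_set _|; apply/setP => J; rewrite finset.in_setU.
  apply/orP/cellsP => [[/sideP[z [? ? ? _]]|/sideP[z [? ? ? _]]]|[z [zi gz JE]]];
    try by exists z.
  have [zj|zj|zj] := ltrgt0P (dot z (a j)).
  - by left; apply/sideP; exists z.
  - by right; apply/sideP; exists z.
  - left; have [e e0 he] := generic_perturb v gz.
    have [|g p] := he e; first by rewrite gtr0_norm.
    apply/sideP; exists (z + e *: v); split=> //.
    + by rewrite dotDl dotZl zi vi mulr0 addr0.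
    + by rewrite p.
    + by rewrite dotDl dotZl zj add0r mulr_gt0.
pose u := crossp (a i) (a j).
have u0 : 0 < dot u u by rewrite dot_gt0 crossp_gen_neq0.
(* [u] spans the new line. An [a k] orthogonal to [u] would lie in [plane i j], and the line would
   not be new. *)
have gu : generic u r.
  move=> k kr; apply: contra pj => /eqP uk.
  have ik : i != k by apply: contraNneq ir => ->.
  apply/mapP; exists k => //; apply/esym/eqP; rewrite plane_gen //.
  apply/mem_planeP; have := crossp_gram (a i) (a j) (a k).
  rewrite -/u (dotC _ u) uk scale0r add0r => /(congr1 (fun x => (dot u u)^-1 *: x)).
  rewrite scalerA mulVf ?gt_eqF // scale1r scalerDr !scalerA => e.
  by eexists; eexists; exact: e.
have gNu : generic (- u) r by move=> k kr; rewrite dotNl oppr_eq0 gu.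
have ui : dot u (a i) = 0 by apply: dot_crosspl.
have uj : dot u (a j) = 0 by apply: dot_crosspr.
have TF x : generic x r -> dot x (a i) = 0 -> dot x (a j) = 0 ->
    positive_part x r \in T :&: F.
  move=> gx xi xj; have [e e0 he] := generic_perturb v gx.
  rewrite finset.in_setI; apply/andP; split; apply/sideP.
  - have [|g p] := he e; first by rewrite gtr0_norm.
    exists (x + e *: v); split=> //; rewrite dotDl dotZl ?xi ?xj ?vi ?add0r ?mulr0 //.
    by rewrite mulr_gt0.
  - have [|g p] := he (- e); first by rewrite normrN gtr0_norm.
    exists (x + - e *: v); split=> //; rewrite dotDl dotZl ?xi ?xj ?vi ?add0r ?mulr0 //.
    by rewrite mulNr oppr_lt0 mulr_gt0.
have -> : T :&: F = [set positive_part u r; positive_part (- u) r]%SET.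
  apply/setP => J; rewrite finset.in_set2; apply/idP/orP; last first.
    by case=> /eqP ->; apply: TF; rewrite ?dotNl ?ui ?uj ?oppr0.
  rewrite finset.in_setI => /andP[/sideP[z1 [zi1 gz1 J1 zj1]] 
    /sideP[z2 [zi2 gz2 J2 zj2]]].
  (* Both weights are positive, so [z] keeps the signs of the cell, and they are balanced to put [z]
     on the line: a cell with points on both sides is met by the line. *)
  pose z := - dot z2 (a j) *: z1 + dot z1 (a j) *: z2.
  have zi : dot z (a i) = 0 by rewrite dotDl !dotZl zi1 zi2 !mulr0 addr0.
  have zj : dot z (a j) = 0 by rewrite dotDl !dotZl; ring.
  have sgz k : k \in r -> if k \in J then 0 < dot z (a k) else dot z (a k) < 0.
    move=> kr; rewrite dotDl !dotZl.
    have b1 : (k \in J) = (0 < dot z1 (a k)) by rewrite J1 inE kr.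
    have b2 : (k \in J) = (0 < dot z2 (a k)) by rewrite J2 inE kr.
    case kJ: (k \in J).
      by rewrite addr_gt0 // mulr_gt0 ?oppr_gt0 // -?b1 -?b2.
    have l1 : dot z1 (a k) < 0 by rewrite lt_neqAle gz1 // leNgt -b1 kJ.
    have l2 : dot z2 (a k) < 0 by rewrite lt_neqAle gz2 // leNgt -b2 kJ.
    by rewrite -(addr0 0) ltrD // pmulr_rlt0 // oppr_gt0.
  have zu : dot u u *: z = dot z u *: u.
    by rewrite crossp_gram zi zj !mul0r !subrr !scale0r !addr0.
  have zk k : dot z (a k) = dot z u / dot u u * dot u (a k).
    have := congr1 (fun x => dot x (a k)) zu; rewrite !dotZl => e.
    by rewrite mulrAC -e mulrAC mulfV ?mul1r // gt_eqF.
  have JE : J = positive_part z r.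
    apply/setP => k; rewrite inE; have [kr|kr] /= := boolP (k \in r); last first.
      by rewrite J1 inE (negPf kr).
    have := sgz k kr; case: ifP => [_ -> //|_ h].
    by rewrite ltNge ltW.
  have [l0|l0|l0] := ltrgt0P (dot z u / dot u u).
  - left; apply/eqP; rewrite JE; apply/setP => k; rewrite !inE zk.
    by rewrite pmulr_rgt0.
  - right; apply/eqP; rewrite JE; apply/setP => k; rewrite !inE zk dotNl.
    by rewrite nmulr_rgt0 // oppr_gt0.
  (* Here all products with [z] vanish, which the strict signs allow only for empty [r]. *)
  - left; apply/eqP; rewrite JE; apply/setP => k; rewrite !inE.
    case: (boolP (k \in r)) => //= kr; have := sgz k kr.
    by rewrite zk l0 mul0r ltxx; case: ifP.
rewrite finset.cards2; case: (eqVneq r [::]) => [r0|rn].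
  rewrite (_ : positive_part u r = positive_part (- u) r) ?eqxx //.
  by apply/setP => k; rewrite !inE r0.
have [k kr] : exists k, k \in r.
  by case: (r) rn => // k s _; exists k; apply: mem_head.
rewrite (_ : _ != _) //; apply/eqP => /setP/(_ k); rewrite !inE kr dotNl oppr_gt0 /=.
by have := gu k kr; case: ltrgt0P.
Qed.

Lemma card_cells i r : uniq r -> i \notin r ->
  #|cells i r| = (if r is [::] then 1
    else (size (undup [seq plane i k | k <- r])).*2)%N.
Proof.
elim: r => [|j r IH]; first by rewrite cells_nil finset.cards1.
rewrite cons_uniq in_cons negb_or => /andP[jr ru] /andP[ij ir] /=.
case: ifP => [pj|/negbT pj].
  rewrite card_cells_old // IH //.
  by case: (r) pj.
rewrite card_cells_new // IH //=.
by case: (r) => //= k s; case: ifP; rewrite addn2.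
Qed.

End Cells.

(** * The correspondence between edges and cells *)

Section ZonotopeEdges.
Context {R : realType}.
Local Notation E := 'rV[R]_3.
Variables (n : nat) (c : E) (a : 'I_n -> E).
Hypothesis nc : pairwise_noncollinear a.
Implicit Types (t : 'I_n -> R) (z x u w : E) (i j k : 'I_n) (J : {set 'I_n}).
Local Notation zpoint := (zpoint c a).
Local Notation zono := (zono c a).

Definition others i : seq 'I_n := [seq j <- enum 'I_n | j != i].

Lemma mem_others i j : (j \in others i) = (j != i).
Proof. by rewrite mem_filter mem_enum andbT. Qed.

Lemma others_uniq i : uniq (others i).
Proof. by rewrite filter_uniq ?enum_uniq. Qed.

(* Gordan's alternative for the vectors [s j *: a j], [j != i], taken modulo
   [a i]. *)
Lemma gordan i (s : 'I_n -> R) : (exists j, j != i) -> a i != 0 ->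
  (exists2 z, dot z (a i) = 0 & forall j, j != i -> 0 < s j * dot z (a j)) \/
  (exists d (g : R), simplex (predC1 i) d /\
    \sum_j (d 0 j * s j) *: a j = g *: a i).
Proof.
move=> [j0 j0i] ai0; have aa : 0 < dot (a i) (a i) by rewrite dot_gt0.
pose prj x := x - (dot (a i) x / dot (a i) (a i)) *: a i.
pose b j := s j *: prj (a j).
have [[d ds db]|nh] := pselect (hull (predC1 i) b 0).
  right; exists d, (\sum_j d 0 j * s j * (dot (a i) (a j) / dot (a i) (a i))).
  split=> //; apply/eqP; rewrite scaler_suml -subr_eq0 -sumrB.
  apply/eqP; transitivity (lincomb b d); last exact: db.
  apply: eq_bigr => j _.
  by apply/rowP => k; rewrite !mxE; ring.
left; have [|z' z'P] := separation
  (@hull_compact _ _ (predC1 i) b) (@hull_cvx _ _ _ _) _ nh.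
  by exists (b j0); apply: hull_vertex.
exists (prj z').
  by rewrite dotBl dotZl (dotC (a i) z') divfK ?subrr // gt_eqF.
move=> j ji; have := z'P (b j) (@hull_vertex _ _ (predC1 i) b j ji).
rewrite dot0r dotZr dotBr dotBl dotZl dotZr (dotC (a i) z').
suff -> : dot (a i) (a j) / dot (a i) (a i) * dot z' (a i) =
  dot z' (a i) / dot (a i) (a i) * dot (a i) (a j) by [].
by ring.
Qed.

Definition corner J : E := zpoint (fun j => (j \in J)%:R).

Lemma box_corner J : box (fun j => (j \in J)%:R : R).
Proof. by move=> j; case: (j \in J); rewrite lexx ler01. Qed.

(** The 0/1 coordinates prescribe the signs of a vector of the cell. If there is no such vector,
    [gordan] gives a nonnegative relation along which the midpoint of the edge moves off the edge in
    two opposite directions inside the zonotope, against extremeness. *)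
Lemma edge_cell i t : (exists j, j != i) -> box t -> t i = 0 ->
  (forall j, j != i -> t j = 0 \/ t j = 1) ->
  edge zono (zpoint t) (zpoint t + a i) ->
  exists2 J, J \in cells a i (others i) & zpoint t = corner J.
Proof.
move=> [j0 j0i] tb ti0 t01 ed.
have ai0 : a i != 0 by apply: (gen_neq0 nc (j := j0)); rewrite eq_sym.
(* With these signs, subtracting a small nonnegative multiple of [s j] from [t j] stays in
   [0, 1]. *)
pose s j : R := if t j == 0 then -1 else 1.
have ex : exists j, j != i by exists j0.
have [[z zi zs]|[d [g [[d0 d1 dD] dg]]]] := gordan s ex ai0.
  exists (positive_part a z (others i)).
    apply/cellsP; exists z; split=> // j; rewrite mem_others => /zs.
    by apply: contraTneq => ->; rewrite mulr0 ltxx.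
  apply: eq_zpoint => j; rewrite inE mem_others.
  have [->|ji] /= := eqVneq j i; first by rewrite ti0.
  have := zs j ji; rewrite /s; have [tj|tj] := t01 j ji; rewrite tj.
    by rewrite eqxx mulN1r oppr_gt0 => h; rewrite ltNge ltW.
  by rewrite oner_eq0 mul1r => ->.
have [k dk] : exists k, 0 < d 0 k.
  apply: (@simplex_pos _ _ d); split=> //.
have di : d 0 i = 0 by apply: dD; rewrite /= eqxx.
have ki : k != i by apply: contraTneq dk => ->; rewrite di ltxx.
(* Small enough that no coordinate moves by more than 1/2; coordinate [i] starts from 1/2 and may
   move either way. *)
pose e : R := (2 * (1 + `|g|))^-1.
have g0 : 0 <= `|g| := normr_ge0 g.
have e0 : 0 < e by rewrite invr_gt0; lra.
have eg : `|e * g| <= 2^-1.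
  rewrite normrM gtr0_norm // /e mulrC ler_pdivrMr; last by lra.
  by rewrite mulrA mulVf ?mul1r ?pnatr_eq0 //; lra.
have e1 : e <= 2^-1.
  by rewrite /e lef_pV2 ?posrE; lra.
have sb j (r : R) : j != i -> 0 <= r <= 2^-1 -> 0 <= t j - r * s j <= 1.
  move=> /t01 h /andP[r0 r1]; rewrite /s; case: h => ->.
    by rewrite eqxx; apply/andP; split; lra.
  by rewrite oner_eq0; apply/andP; split; lra.
have db j : 0 <= e * d 0 j <= 2^-1.
  rewrite mulr_ge0 ?(ltW e0) //=.
  have : d 0 j <= 1.
    by rewrite -d1 (bigD1 j) //= lerDl; apply: sumr_ge0.
  by move=> h; apply: le_trans e1; rewrite ler_piMr // ltW.
pose th := upd t i 2^-1.
(* [y1] moves coordinate [k] alone and [y2] all the other ones, with [e * g] in coordinate [i]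
   compensating; the relation makes the two displacements opposite. *)
pose y1 := upd th k (t k - e * d 0 k * s k).
pose y2 j : R := if j == i then 2^-1 + e * g
  else if j == k then t k else t j - e * d 0 j * s j.
have b1 : box y1.
  apply: box_upd; last exact: sb.
  by apply: box_upd => //; apply/andP; split; lra.
have b2 : box y2.
  move=> j; rewrite /y2; case: eqP => [_|/eqP ji].
    by move: eg; rewrite ler_norml => /andP[? ?]; apply/andP; split; lra.
  by case: eqP => _; [apply: tb|apply: sb].
have mid : 2^-1 *: zpoint y1 + (1 - 2^-1) *: zpoint y2 = zpoint t + 2^-1 *: a i.
  rewrite zpoint_comb.
  have -> : zpoint t + 2^-1 *: a i = zpoint th by rewrite zpoint_upd ti0 subr0.
  have dg' : \sum_j (d 0 j * s j) *: a j - g *: a i = 0 by rewrite dg subrr.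
  apply/eqP; rewrite -subr_eq0 -(scaler0 _ (- (e / 2))) -dg'.
  rewrite opprD addrACA subrr add0r.
  have -> : g *: a i = \sum_j ((j == i)%:R * g) *: a j.
    rewrite (bigD1 i) //= eqxx mul1r big1 ?addr0 // => j /negPf ->.
    by rewrite mul0r scale0r.
  rewrite -!sumrB scaler_sumr; apply/eqP/eq_bigr => j _.
  rewrite -!scalerBl scalerA; congr (_ *: _).
  rewrite /y1 /y2 /th /upd; case: (eqVneq j k) => [->|jk].
    by rewrite ?eqxx (negPf ki) /= mul0r; field.
  by case: eqP => [->|_] /=; rewrite ?di ?mul0r ?mul1r; field.
have [_ _ _ h] := ed.
have h2 : 0 < (2^-1 : R) < 1 by apply/andP; split; lra.
have Z1 : zono (zpoint y1) by exists y1.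
have Z2 : zono (zpoint y2) by exists y2.
have sm : seg (zpoint t) (zpoint t + a i)
    (2^-1 *: zpoint y1 + (1 - 2^-1) *: zpoint y2).
  rewrite mid; exists 2^-1; first by apply/andP; split; lra.
  by rewrite [X in _ *: (X - _)]addrC addrK.
(* If the point of [y1] were on the edge, [a k] would be a multiple of [a i]. *)
have [r _] := h _ _ _ Z1 Z2 h2 sm.
rewrite zpoint_upd zpoint_upd /th /upd (negPf ki) ti0.
rewrite [X in _ *: (X - _)]addrC addrK => e'.
have [||_ /eqP] := @noncol_coef _ _ _ nc i k (2^-1 - r) (- (e * d 0 k * s k)).
- by rewrite eq_sym.
- move/eqP: e'; rewrite -subr_eq0 => /eqP e'; rewrite -e'.
  by apply/rowP => l; rewrite !mxE; ring.
rewrite oppr_eq0 !mulf_eq0 (gt_eqF e0) (gt_eqF dk) /= /s.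
by case: ifP => _; rewrite ?oppr_eq0 oner_eq0.
Qed.

Lemma dot_corner_gap i J z t : dot z (a i) = 0 ->
  J = positive_part a z (others i) ->
  dot z (corner J) - dot z (zpoint t) =
    \sum_j ((j \in J)%:R - t j) * dot z (a j).
Proof.
move=> zi JE; rewrite !dot_zpoint opprD addrACA subrr add0r -sumrB.
by apply: eq_bigr => j _; rewrite mulrBl.
Qed.

Lemma corner_gap_ge0 i J z t j : dot z (a i) = 0 ->
  J = positive_part a z (others i) -> box t ->
  0 <= ((j \in J)%:R - t j) * dot z (a j).
Proof.
move=> zi -> tb; rewrite inE mem_others.
have [->|ji] /= := eqVneq j i; first by rewrite zi mulr0.
have /andP[t0 t1] := tb j; case: ltP => h.
  by rewrite mulr_ge0 ?subr_ge0 // ltW.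
by rewrite sub0r mulr_le0 // oppr_le0.
Qed.

(** The gap to the maximum of [z] is a sum of nonnegative terms in which [dot z (a j)] is nonzero
    for [j != i]; only coordinate [i] remains free on the maximal face. *)
Lemma corner_unique i J z t : dot z (a i) = 0 -> generic a z (others i) ->
  J = positive_part a z (others i) -> box t ->
  dot z (corner J) <= dot z (zpoint t) -> forall j, j != i -> t j = (j \in J)%:R.
Proof.
move=> zi gz JE tb le j ji; have nn := fun j => corner_gap_ge0 j zi JE tb.
have /eqP : \sum_j ((j \in J)%:R - t j) * dot z (a j) = 0.
  apply/eqP; rewrite eq_le sumr_ge0 // andbT -(dot_corner_gap t zi JE).
  by rewrite subr_le0.
rewrite psumr_eq0 // => /allP/(_ j (mem_index_enum j)) /=.
by rewrite mulf_eq0 subr_eq0 (negPf (gz j _)) ?mem_others // orbF => /eqP.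
Qed.

Lemma corner_inj i : {in cells a i (others i) &, injective corner}.
Proof.
move=> J J' /cellsP[z [zi gz JE]] /cellsP[z' [_ _ JE']] e; apply/setP => j.
have [->|ji] := eqVneq j i; first by rewrite JE JE' !inE mem_others eqxx.
have := corner_unique zi gz JE (box_corner J') (_ : _ <= dot z (corner J')) ji.
rewrite e lexx => /(_ isT) /eqP.
by do 2!case: (_ \in _); rewrite ?eqxx // ?oner_eq0 // eq_sym oner_eq0.
Qed.

(** The segment is the face on which a vector [z] of the cell attains its maximum. *)
Lemma corner_edge i J : a i != 0 -> J \in cells a i (others i) ->
  edge zono (corner J) (corner J + a i).
Proof.
move=> ai0 /cellsP[z [zi gz JE]].
have iJ : i \notin J by rewrite JE inE mem_others eqxx.
have cE : corner J + a i = zpoint (upd (fun j => (j \in J)%:R) i 1).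
  by rewrite zpoint_upd (negPf iJ) subr0 scale1r.
split.
- apply: contraNneq ai0 => e; apply/eqP/(addrI (corner J)).
  by rewrite -e addr0.
- by exists (fun j => (j \in J)%:R) => //; apply: box_corner.
- rewrite cE; eexists; last by [].
  by apply: box_upd; rewrite ?lexx ?ler01 //; apply: box_corner.
move=> _ _ s [t tb <-] [t' tb' <-] /andP[s0 s1] [r _ rE].
have top t0 : box t0 -> dot z (zpoint t0) <= dot z (corner J).
  move=> t0b; rewrite -subr_ge0 (dot_corner_gap t0 zi JE).
  by apply: sumr_ge0 => j _; apply: (corner_gap_ge0 j zi JE).
have le : dot z (corner J) <= dot z (zpoint t).
  have := congr1 (dot z) rE; rewrite [X in _ *: (X - _)]addrC addrK.
  rewrite (dotDr z (s *: _)) (dotDr z (corner J)) !dotZr zi mulr0 addr0 => e.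
  have s1' : 0 < 1 - s by lra.
  have h' := ler_wpM2l (ltW s1') (top t' tb').
  rewrite -(ler_pM2l s0); lra.
have tJ := corner_unique zi gz JE tb le.
exists (t i) => //; rewrite [X in _ *: (X - _)]addrC addrK.
rewrite -[X in X *: _]subr0 -(_ : (i \in J)%:R = 0 :> R); last by rewrite (negPf iJ).
rewrite -[t i - _]/(t i - (fun j => (j \in J)%:R) i) -zpoint_upd.
by apply: eq_zpoint => j; rewrite /upd; case: eqP => [-> //|/eqP/tJ].
Qed.

Definition half_edges : seq (E * E) :=
  [seq (corner J, corner J + a i) | i <- enum 'I_n, J <- enum (cells a i (others i))].

Definition zono_edges : seq (E * E) :=
  half_edges ++ [seq (p.2, p.1) | p <- half_edges].

Hypothesis n2 : (2 <= n)%N.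

Lemma exists_other i : exists j, j != i.
Proof.
have [e|ne] := eqVneq i (Ordinal n2); last by exists (Ordinal n2); rewrite eq_sym.
by exists (Ordinal (ltnW n2)); rewrite e.
Qed.

Lemma generator_neq0 i : a i != 0.
Proof.
by have [j ji] := exists_other i; apply: (gen_neq0 nc (j := j)); rewrite eq_sym.
Qed.

Lemma half_edgesP u w : reflect
  (exists i J, [/\ J \in cells a i (others i), u = corner J & w = corner J + a i])
  ((u, w) \in half_edges).
Proof.
apply: (iffP allpairsPdep).
  by move=> [i [J [_]]]; rewrite mem_enum => Jc [-> ->]; exists i, J.
by move=> [i [J [Jc -> ->]]]; exists i, J; rewrite !mem_enum.
Qed.

Lemma swap_half_edgesP u w :
  ((u, w) \in [seq (p.2, p.1) | p <- half_edges]) = ((w, u) \in half_edges).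
Proof.
apply/mapP/idP => [[[u' w'] h [-> ->]] //|h].
by exists (w, u).
Qed.

Lemma zono_edgesP u w : (u, w) \in zono_edges <-> edge zono u w.
Proof.
have half p q : (p, q) \in half_edges -> edge zono p q.
  by move=> /half_edgesP[i [J [Jc -> ->]]]; apply: corner_edge (generator_neq0 i) Jc.
rewrite mem_cat swap_half_edgesP; split=> [/orP[/half //|/half/edge_sym //]|ed].
have [i [t [tb t01 ti h]]] := edge_generator nc ed.
have [[uE wE]|[wE uE]] := h.
  apply/orP; left; rewrite uE wE in ed.
  have [J Jc tJ] := edge_cell (exists_other i) tb ti t01 ed.
  by apply/half_edgesP; exists i, J; rewrite uE wE tJ.
apply/orP; right; rewrite uE wE in ed.
have [J Jc tJ] := edge_cell (exists_other i) tb ti t01 (edge_sym ed).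
by apply/half_edgesP; exists i, J; rewrite uE wE tJ.
Qed.

Lemma gen_inj : injective a.
Proof.
move=> i j ij; apply/eqP; apply: contraT => nij.
have [|/eqP] := @noncol_coef _ _ _ nc i j 1 (-1) nij.
  by rewrite ij -scalerDl subrr scale0r.
by rewrite oner_eq0.
Qed.

Lemma zono_edges_uniq : uniq zono_edges.
Proof.
have hu : uniq half_edges.
  apply: allpairs_uniq_dep; first exact: enum_uniq.
    by move=> i _; apply: enum_uniq.
  move=> [i J] [i' J'] /allpairsPdep[i1 [J1 [_ J1c [e1 e2]]]].
  move=> /allpairsPdep[i2 [J2 [_ J2c [e3 e4]]]] /=.
  rewrite /= in e1 e2 e3 e4; subst i1 J1 i2 J2 => -[cJ].
  rewrite cJ => /addrI/gen_inj ii; subst i'.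
  suff -> : J = J' by [].
  by rewrite !mem_enum in J1c J2c; apply: corner_inj J1c J2c cJ.
rewrite cat_uniq hu andTb map_inj_uniq ?hu ?andbT; last first.
  by move=> [u w] [u' w'] [-> ->].
apply/hasPn => -[u w]; rewrite swap_half_edgesP => /half_edgesP[i [J [_ wE uE]]].
apply/half_edgesP => -[i' [J' [_ uE' wE']]].
(* A pair occurring both along and against a generator would make two generators opposite. *)
have e : a i + a i' = 0.
  apply: (addrI w); rewrite addr0 {2}wE' -uE' uE -wE addrA //.
have [ii|ii] := eqVneq i i'.
  move: e; rewrite ii -mulr2n -scaler_nat => /eqP.
  by rewrite scaler_eq0 pnatr_eq0 (negPf (generator_neq0 i')).
have [|/eqP] := @noncol_coef _ _ _ nc i i' 1 1 ii; first by rewrite !scale1r.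
by rewrite oner_eq0.
Qed.

Lemma sum_zono_edges z : \sum_(p <- zono_edges) `|dot z (p.2 - p.1)| =
  \sum_i (2 * #|cells a i (others i)|)%:R * `|dot z (a i)|.
Proof.
have hs : \sum_(p <- half_edges) `|dot z (p.2 - p.1)| =
    \sum_i #|cells a i (others i)|%:R * `|dot z (a i)|.
  rewrite big_allpairs_dep big_enum /=; apply: eq_bigr => i _.
  rewrite big_enum /= (eq_bigr (fun=> `|dot z (a i)|)) => [|J _].
    by rewrite sumr_const mulr_natl.
  by rewrite (addrC (corner J)) addrK.
rewrite big_cat big_map /= [X in _ + X](eq_bigr (fun p => `|dot z (p.2 - p.1)|)).
  rewrite hs -big_split; apply: eq_bigr => i _ /=.
  by rewrite -mulrDl -natrD mul2n addnn.
by move=> p _; rewrite -normrN -dotNr opprB.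
Qed.

Lemma card_cells_others i : #|cells a i (others i)| =
  (2 * size (undup [seq plane a i j | j <- others i]))%N.
Proof.
rewrite card_cells ?others_uniq ?mem_others ?eqxx // mul2n.
have [j] := exists_other i; rewrite -mem_others.
by case: (others i).
Qed.

End ZonotopeEdges.

(** * The degree as a number of planes *)

Section Degree.
Context {R : realType}.
Local Notation E := 'rV[R]_3.
Variables (n : nat) (a : 'I_n -> E).
Hypothesis nc : pairwise_noncollinear a.
Implicit Types (i j : 'I_n).
Local Notation V := (generator_set a).

Lemma generatorP v : reflect (exists i, v = a i) (v \in V).
Proof.
apply: (iffP (imfsetP _ _ _ _)) => [[i _ ->]|[i ->]]; first by exists i.
by exists i.
Qed.

Lemma dim_linE (W : {fset E}) : dim_lin W = \dim <<W>>%VS.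
Proof. by []. Qed.

Lemma span_fset1U v (W : {fset E}) :
  (<<(v |` W)%fset>> = <[v]> + <<W>>)%VS.
Proof.
rewrite -span_cons; apply/eqP; rewrite eqEsubv; apply/andP; split;
  apply/span_subvP => x.
  by rewrite !inE => xW; apply: memv_span; rewrite inE.
by rewrite inE => xW; apply: memv_span; rewrite !inE.
Qed.

Definition plane_gens (U : {vspace E}) : {fset E} := [fset v in V | v \in U]%fset.

Lemma span_plane_gens i j : i != j -> <<plane_gens (plane a i j)>>%VS = plane a i j.
Proof.
move=> ij; apply/eqP; rewrite eqEsubv; apply/andP; split; apply/span_subvP => x.
  by rewrite !inE => /andP[].
move=> xij; apply: memv_span; rewrite !inE /= memv_span // andbT.
by move: xij; rewrite !inE => /orP[]/eqP ->; apply/generatorP; eexists.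
Qed.

Lemma plane_gens_hyperedge i j : i != j ->
  hyperedge V (plane_gens (plane a i j)) /\ a i \in plane_gens (plane a i j).
Proof.
move=> ij; split; last first.
  rewrite !inE /=; apply/andP; split; first by apply/generatorP; exists i.
  by apply: memv_span; rewrite !inE eqxx.
split.
- by apply/fsubsetP => x; rewrite !inE => /andP[].
- by rewrite dim_linE span_plane_gens // (dim_plane nc).
move=> v; rewrite !inE => /andP[h vV]; rewrite /= vV /= in h.
rewrite dim_linE span_fset1U span_plane_gens //.
suff dv : (<[v]> :&: plane a i j = 0)%VS.
  have v0 : v != 0 by apply: contraNneq h => ->; apply: mem0v.
  by rewrite dimv_disjoint_sum // (dim_plane nc ij) dim_vline v0.
apply/eqP; rewrite -subv0; apply/subvP => x; rewrite memv_cap memv0.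
move=> /andP[/vlineP[k ->]]; have [->|k0] := eqVneq k 0; first by rewrite scale0r.
by move=> /(memvZ k^-1); rewrite scalerA mulVf // scale1r (negPf h).
Qed.

(** A second generator exists because one vector cannot span dimension 2. The two have the same span
    as [W], and maximality puts every generator of that plane into [W]. *)
Lemma hyperedge_plane_gens i (W : {fset E}) : hyperedge V W -> a i \in W ->
  exists2 j, i != j & W = plane_gens (plane a i j).
Proof.
move=> [/fsubsetP WV dW mW] iW; have ispan : a i \in <<W>>%VS by apply: memv_span.
have [j ij jW] : exists2 j, i != j & a j \in W.
  apply: contrapT => h; have : (<<W>> <= <[a i]>)%VS.
    apply/span_subvP => x xW; have /generatorP[j xE] := WV x xW.
    have [e|ij] := eqVneq i j; first by rewrite xE -e memv_line.
    by case: h; exists j => //; rewrite -xE.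
  by move=> /dimvS; rewrite -dim_linE dW dim_vline; case: (_ != _).
have UW : plane a i j = <<W>>%VS.
  apply/eqP; rewrite eqEdim (dim_plane nc ij) -dim_linE dW leqnn andbT.
  by apply/span_subvP => x; rewrite !inE => /orP[]/eqP -> //; apply: memv_span.
exists j => //; rewrite UW; apply/fsetP => x; rewrite !inE /=.
apply/idP/andP => [xW|[xV xW]]; first by rewrite WV // memv_span.
apply: contraT => nxW; have : x \in (V `\` W)%fset by rewrite inE nxW.
move=> /mW; rewrite dim_linE span_fset1U (addv_idPr _) -?dim_linE ?dW //.
Qed.

(** A hyperedge is recovered from its span, and the spans of those through [a i] are the planes
    through [a i] and another generator. *)
Lemma degreeE i :
  degree V (a i) = size (undup [seq plane a i j | j <- others i]).
Proof.
set L := [seq _ | j <- _]; rewrite /degree.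
have inL U : U \in undup L -> exists2 j, i != j & U = plane a i j.
  by rewrite mem_undup => /mapP[j]; rewrite mem_others eq_sym; exists j.
have -> : [fset W in fpowerset V | `[< hyperedge V W >] && (a i \in W)]%fset =
    [fset W in map plane_gens (undup L)]%fset.
  apply/fsetP => W; rewrite !inE /= fpowersetE.
  apply/idP/mapP => [/andP[_ /andP[/asboolP h iW]]|[U /inL[j ij ->] ->]].
    have [j ij ->] := hyperedge_plane_gens h iW.
    by exists (plane a i j); rewrite // mem_undup map_f // mem_others eq_sym.
  have [h iW] := plane_gens_hyperedge ij.
  by rewrite iW andbT; apply/andP; split; [case: h|apply/asboolP].
rewrite card_fseq undup_id ?size_map // map_inj_in_uniq ?undup_uniq //.
move=> U U' /inL[j ij ->] /inL[j' ij' ->] e.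
by rewrite -(span_plane_gens ij) e span_plane_gens.
Qed.

End Degree.

(** * Linear independence of the width functions and the main theorem *)

Section Generators.
Context {R : realType}.
Local Notation E := 'rV[R]_3.

Lemma free_pair_sym (x y : E) : free [:: x; y] -> free [:: y; x].
Proof.
by move=> /free_pairP h; apply/free_pairP => k l; rewrite addrC => /h[-> ->].
Qed.

Lemma free_pairZ (x y : E) (q : R) : q != 0 -> free [:: x; y] -> free [:: q *: x; y].
Proof.
move=> q0 /free_pairP h; apply/free_pairP => k l; rewrite scalerA => /h[/eqP + ->].
by rewrite mulf_eq0 (negPf q0) orbF => /eqP.
Qed.

(** Only absolute values of products occur, so orientation is irrelevant and collinear vectors merge
    by adding lengths; zero vectors are dropped. *)
Lemma merge_collinear (s : seq E) : exists n (a : 'I_n -> E),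
  pairwise_noncollinear a /\
  forall z, \sum_(e <- s) `|dot z e| = \sum_i `|dot z (a i)|.
Proof.
suff [r [ru r0 rf rs]] : exists r : seq E, [/\ uniq r, forall x, x \in r -> x != 0,
    forall x y, x \in r -> y \in r -> x != y -> free [:: x; y]
  & forall z, \sum_(e <- s) `|dot z e| = \sum_(x <- r) `|dot z x|].
  exists (size r), (fun i => r`_i); split=> [i j ij|z].
    by apply: rf; rewrite ?mem_nth // nth_uniq.
  by rewrite rs (big_nth 0) big_mkord.
elim: s => [|e s [r [ru r0 rf rs]]]; first by exists [::]; split=> // z; rewrite !big_nil.
have [e0|e0] := eqVneq e 0.
  by exists r; split=> // z; rewrite big_cons rs e0 dot0r normr0 add0r.
have [[x xr [k ek]]|nh] := pselect (exists2 x, x \in r & exists k : R, e = k *: x).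
  (* The terms of [x] and [k *: x] add up to that of [(1 + |k|) *: x]. *)
  pose q : R := 1 + `|k|.
  have q0 : 0 < q by rewrite ltr_pwDl.
  have fx w : w \in rem x r -> free [:: q *: x; w].
    rewrite mem_rem_uniq // inE => /andP[wx wr].
    by apply: free_pairZ; rewrite ?gt_eqF // rf // eq_sym.
  exists (q *: x :: rem x r); split.
  - rewrite /= rem_uniq // andbT; apply/negP => /fx /free_pairP /(_ 1 (- 1)).
    by rewrite -scalerDl subrr scale0r => /(_ erefl)[/eqP]; rewrite oner_eq0.
  - move=> w; rewrite in_cons => /predU1P[->|/mem_rem /r0 //].
    by rewrite scaler_eq0 negb_or gt_eqF // r0.
  - move=> w w'; rewrite !in_cons => /predU1P[->|wr] /predU1P[->|w'r].
    + by rewrite eqxx.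
    + by move=> _; apply: fx.
    + by move=> _; apply/free_pair_sym/fx.
    + by apply: rf; apply: mem_rem; eassumption.
  - move=> z; rewrite !big_cons rs (perm_big _ (perm_to_rem xr)) big_cons addrA.
    congr (_ + _); rewrite ek !dotZr !normrM (gtr0_norm q0) /q; ring.
have fe x : x \in r -> free [:: x; e].
  move=> xr; apply: contrapT => nf; apply: nh; exists x => //.
  move: nf; rewrite free_cons seq1_free e0 andbT span_seq1 => /negP; rewrite negbK.
  move=> /vlineP[k xE]; exists k^-1; rewrite xE scalerA mulVf ?scale1r //.
  by apply: contraTneq (r0 _ xr) => k0; rewrite xE k0 scale0r eqxx.
exists (e :: r); split.
- rewrite /= ru andbT; apply/negP => /fe /free_pairP /(_ 1 (- 1)).
  by rewrite -scalerDl subrr scale0r => /(_ erefl)[/eqP]; rewrite oner_eq0.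
- by move=> w; rewrite in_cons => /predU1P[->|/r0].
- move=> w w'; rewrite !in_cons => /predU1P[->|wr] /predU1P[->|w'r].
  + by rewrite eqxx.
  + by move=> _; apply/free_pair_sym/fe.
  + by move=> _; apply: fe.
  + exact: rf.
- by move=> z; rewrite !big_cons rs.
Qed.

Section Noncollinear.
Variables (n : nat) (a : 'I_n -> E).
Hypothesis nc : pairwise_noncollinear a.

(** Take the second difference in direction [a i] at a point orthogonal to [a i] and to no other
    generator: the term of [a i] has a kink there, while the others are linear nearby. *)
Lemma norm_dot_indep (mu : 'I_n -> R) : (2 <= n)%N ->
  (forall z, z != 0 -> \sum_i mu i * `|dot z (a i)| = 0) -> forall i, mu i = 0.
Proof.
move=> n2 h0 i.
have h z : \sum_i mu i * `|dot z (a i)| = 0.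
  have [->|/h0 //] := eqVneq z 0.
  by rewrite big1 // => j _; rewrite dot0l normr0 mulr0.
(* Such a point exists because the number of cells is positive. *)
have [J /cellsP[z [zi gz _]]] : exists J, J \in cells a i (others i).
  apply/set0Pn; rewrite -finset.card_gt0 card_cells_others // muln_gt0 /=.
  have [j ji] := exists_other n2 i.
  rewrite lt0n size_eq0; apply/eqP => /(congr1 (fun s => plane a i j \in s)).
  by rewrite mem_undup map_f ?mem_others.
have [e e0 he] := generic_perturb (a i) gz.
have [|g1 p1] := he e; first by rewrite gtr0_norm.
have [|g2 p2] := he (- e); first by rewrite normrN gtr0_norm.
have aa : 0 < dot (a i) (a i) by rewrite dot_gt0 generator_neq0.
have D x : mu i * `|dot x (a i)| + \sum_(j < n | j != i) mu j * `|dot x (a j)| = 0.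
  by have := h x; rewrite (bigD1 i).
have := D (z + e *: a i); have := D (z - e *: a i); have := D z.
rewrite !dotDl !dotNl !dotZl zi normr0 mulr0 !add0r normrN.
rewrite gtr0_norm ?mulr_gt0 // => s0 s1 s2.
(* For [j != i] the product has the same sign at all three points, so the absolute values add up
   linearly. *)
have e3 : \sum_(j < n | j != i) mu j * `|dot (z + e *: a i) (a j)| +
    \sum_(j < n | j != i) mu j * `|dot (z - e *: a i) (a j)| =
    2 * \sum_(j < n | j != i) mu j * `|dot z (a j)|.
  rewrite -big_split mulr_sumr; apply: eq_bigr => j ji /=.
  have jo : j \in others i by rewrite mem_others.
  have := g1 j jo; have := g2 j jo; have := gz j jo.
  have /setP/(_ j) := p1; have /setP/(_ j) := p2.
  rewrite !inE jo /= scaleNr !dotDl !dotNl !dotZl.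
  move: (dot z (a j)) (e * _) => p q.
  by case: (ltrgt0P p); case: (ltrgt0P (p + q)); case: (ltrgt0P (p - q)) => //; lra.
have /eqP : mu i * (e * dot (a i) (a i)) = 0 by lra.
by rewrite !mulf_eq0 (gt_eqF e0) (gt_eqF aa) !orbF => /eqP.
Qed.

End Noncollinear.

Lemma orthogonal_few n (a : 'I_n -> E) : (n < 3)%N ->
  exists2 z, z != 0 & forall i, dot z (a i) = 0.
Proof.
move=> n3; pose A : 'M[R]_(3, n) := \matrix_(k, i) a i 0 k.
have : kermx A != 0.
  rewrite kermx_eq0 /row_free; apply: contraTneq n3 => rA.
  by rewrite -leqNgt -rA rank_leq_col.
move=> /rowV0Pn[z /sub_kermxP zA z0]; exists z => // i.
have := congr1 (fun M : 'M[R]_(1, n) => M 0 i) zA; rewrite !mxE => <-.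
by apply: eq_bigr => k _; rewrite mxE.
Qed.

(** In the direction separating a point of [K1] from [K2], the minimum over [K1] would lie strictly
    below that over [K2]. *)
Lemma support_sub (K1 K2 : set E) : compact K1 -> K1 !=set0 ->
  compact K2 -> cvx K2 -> K2 !=set0 ->
  (forall z, z != 0 -> tmin K1 z = tmin K2 z) -> K1 `<=` K2.
Proof.
move=> c1 n1 c2 v2 n2 h p K1p; apply: contrapT => nK2p.
have [z zP] := separation c2 v2 n2 nK2p.
have [x K2x [xE _]] := compact_tmin z c2 n2.
have [y _ [yE ymin]] := compact_tmin z c1 n1.
have z0 : z != 0.
  by apply/eqP => z0; have := zP _ K2x; rewrite z0 !dot0l ltxx.
have := zP _ K2x; have := ymin _ K1p; rewrite -xE -yE h //.
by move=> /le_lt_trans /[apply]; rewrite ltxx.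
Qed.

End Generators.

(** * Zonotopes and constant averages *)

Section AverageZonotope.
Context {R : realType}.
Local Notation E := 'rV[R]_3.
Implicit Types (P : set E) (z : E).

Lemma polytope_hull P : convex_polytope P ->
  exists m (v : 'I_m -> E), P = hull predT v.
Proof. by move=> [A fA ->]; apply: convex_hullE. Qed.

(** With fewer generators some nonzero [z] is orthogonal to all of them, and the width in that
    direction vanishes. *)
Lemma zonotope_many P n c (a : 'I_n -> E) : P = zono c a ->
  interior P !=set0 -> (3 <= n)%N.
Proof.
move=> PE iP; rewrite leqNgt; apply/negP => /(orthogonal_few a)[z z0 za].
have := interior_extent (_ : compact P) iP z0.
rewrite PE => /(_ (@zono_compact _ _ _ _)).
by rewrite -subr_gt0 zono_extent big1 ?ltxx // => i _; rewrite za normr0.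
Qed.

Lemma avg_vertices_zono P n c (a : 'I_n -> E) z : convex_polytope P ->
  P = zono c a -> pairwise_noncollinear a -> (2 <= n)%N ->
  tmin P z < tmax P z ->
  avg_vertices P z * \sum_i `|dot z (a i)| =
  \sum_i (2 * degree (generator_set a) (a i))%:R * `|dot z (a i)|.
Proof.
move=> /polytope_hull[m [v PE]] PZ nc n2 tt.
have KP u w : (u, w) \in zono_edges c a <-> edge (hull predT v) u w.
  by rewrite -PE PZ; apply: zono_edgesP.
have Ku : uniq (zono_edges c a) by apply: zono_edges_uniq.
rewrite -(zono_extent c) -PZ PE (avg_vertices_edges Ku KP); last 2 first.
- by rewrite -PE PZ; apply: zono_nonempty.
- by rewrite -PE.
rewrite (sum_edges_norm Ku KP) sum_zono_edges mulr_sumr; apply: eq_bigr => i _.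
(* Two orientations and two cells per line give [2 * (2 * deg)], of which the factor 1/2 cancels one
   2. *)
rewrite card_cells_others // (degreeE nc) (natrM _ 2 (2 * _)).
by rewrite mulrA mulKf // pnatr_eq0.
Qed.

(** Together with the width this determines both extreme values of [z] on [P]. *)
Lemma symmetric_extent P z c : compact P -> P !=set0 ->
  (forall x, P x <-> P (c + c - x)) -> tmax P z + tmin P z = 2 * dot z c.
Proof.
move=> cP P0 sym; have [x Px [xE xmin]] := compact_tmin z cP P0.
rewrite xE (@tmax_attained _ _ _ (c + c - x)).
- by rewrite dotBr dotDr; ring.
- exact: (sym x).1 Px.
- by move=> y /sym /xmin; rewrite !dotBr !dotDr; lra.
Qed.

Lemma avg_const_zono P (lambda : R) : convex_polytope P ->
  centrally_symmetric P -> interior P !=set0 ->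
  (forall z, z != 0 -> avg_vertices P z = lambda) ->
  exists n c (a : 'I_n -> E), pairwise_noncollinear a /\ P = zono c a.
Proof.
move=> /polytope_hull[m [v PE]] [c0 sym] iP avg.
have cP : compact P by rewrite PE; apply: hull_compact.
have P0 : P !=set0 by case: iP => x /interior_subset; exists x.
have ext z : z != 0 -> tmin P z < tmax P z := interior_extent cP iP.
have [K Ku KP] := edge_list v.
have F z : z != 0 -> lambda * (tmax P z - tmin P z) =
    \sum_(p <- K) Num.max (dot z p.2 - dot z p.1) 0.
  move=> z0; rewrite -(avg z z0) PE; apply: avg_vertices_edges => //.
    by rewrite -PE.
  by rewrite -PE; apply: ext.
(* One nonzero direction is enough: both the edge sum and the width are positive there. *)
have l0 : 0 < lambda.
  pose z : E := const_mx 1.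
  have z0 : z != 0.
    by apply/eqP => /rowP/(_ ord0); rewrite !mxE => /eqP; rewrite oner_eq0.
  have := @sum_edges_gt0 _ _ v K Ku KP z; rewrite -F // -PE.
  by move=> /(_ P0 (ext z z0)); rewrite pmulr_lgt0 // subr_gt0 ext.
(* The additional factor 2 accounts for [K] listing each edge in both orientations. *)
have [n [a [nc aE]]] := merge_collinear
  [seq (2 * lambda)^-1 *: (p.2 - p.1) | p <- K].
have width z : z != 0 -> tmax P z - tmin P z = \sum_i `|dot z (a i)|.
  move=> z0; rewrite -aE big_map.
  apply: (mulfI (lt0r_neq0 l0)); rewrite F // (sum_edges_norm Ku KP) !mulr_sumr.
  apply: eq_bigr => p _; rewrite dotZr normrM gtr0_norm ?invr_gt0 ?mulr_gt0 //.
  by field; rewrite gt_eqF.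
(* Chosen so that the zonotope has the same centre [c0] as [P]. *)
pose c := c0 - 2^-1 *: \sum_i a i.
exists n, c, a; split=> //.
have tm z : z != 0 -> tmin P z = tmin (zono c a) z.
  move=> z0; have := symmetric_extent z cP P0 sym; have := width z z0.
  rewrite zono_tmin /c dotBr dotZr dot_sumr.
  suff -> : \sum_i Num.min (dot z (a i)) 0 =
    2^-1 * \sum_i dot z (a i) - 2^-1 * \sum_i `|dot z (a i)| by lra.
  rewrite -mulrBr -sumrB mulr_sumr; apply: eq_bigr => i _.
  by case: (leP 0 (dot z (a i))) => h; [rewrite ger0_norm //|rewrite ltr0_norm //]; field.
apply/seteqP; split; apply: support_sub => //;
  rewrite ?PE; by [apply: zono_compact|apply: zono_cvx|apply: zono_nonempty
    |apply: hull_cvx|rewrite -PE|move=> z z0; rewrite -PE tm].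
Qed.

End AverageZonotope.

Theorem theorem1 (R : realType) (P : set 'rV[R]_3) (lambda : R) :
  convex_polytope P -> centrally_symmetric P -> interior P !=set0 ->
  (forall z : 'rV[R]_3, z != 0 -> avg_vertices P z = lambda) <->
  (exists (n : nat) (a : 'I_n -> 'rV[R]_3),
      is_zonotope_generated_by P a /\
      forall v, v \in generator_set a ->
        (2 * degree (generator_set a) v)%:R = lambda).
Proof.
move=> pP sP iP.
have cP : compact P.
  by have [m [v ->]] := polytope_hull pP; apply: hull_compact.
split=> [avg|[n [a [[n3 nc [c]]]]]].
  have [n [c [a [nc PE]]]] := avg_const_zono pP sP iP avg.
  have n3 := zonotope_many PE iP; have n2 := ltnW n3.
  exists n, a; split.
    by split=> //; exists c; rewrite translate_zonotope.
  (* Average times width is computed once with the constant [lambda] and once with the degrees; the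
     difference is a vanishing combination of the functions |z . a_i|. *)
  have h := @norm_dot_indep _ _ _ nc
    (fun i => (2 * degree (generator_set a) (a i))%:R - lambda) n2 _.
  move=> _ /generatorP[i ->]; apply/eqP; rewrite -subr_eq0 h // => z z0.
  under eq_bigr do rewrite mulrBl.
  rewrite sumrB -mulr_sumr -(avg_vertices_zono pP PE nc n2).
    by rewrite avg // subrr.
  exact: interior_extent.
rewrite translate_zonotope => PE deg z z0.
have tt := interior_extent cP iP z0.
have := avg_vertices_zono pP PE nc (ltnW n3) tt.
have degi i : (2 * degree (generator_set a) (a i))%:R = lambda.
  by apply: deg; apply/generatorP; exists i.
under [RHS]eq_bigr do rewrite degi.
(* The width cancels, being positive because [P] has interior points. *)
rewrite -mulr_sumr; apply: mulIf.
by rewrite -(zono_extent c) -PE subr_eq0 gt_eqF.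
Qed.
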